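(* Let $p_1,p_2,q$ be distinct primes with $p_1\equiv p_2\equiv -q\equiv1\pmod 4$, $k=\mathbb{Q}(\sqrt{p_1p_2q},i)$ with absolute genus field $k^{( * )}$, and $\epsilon_{p_1p_2q}=x+y\sqrt{p_1p_2q}$ with $x,y\in\mathbb{Z}$ the fundamental unit of $\mathbb{Q}(\sqrt{p_1p_2q})$. 1. If $x\pm1$ is a square in $\mathbb{N}$, then $\langle[\mathcal H_1],[\mathcal H_2],[\mathcal H_3],[\mathcal H_4]\rangle\subseteq\kappa_{k^{( * )}}$. 2. If $p_1(x\pm1)$ or $2p_1(x\pm1)$ is a square in $\mathbb{N}$, then $\langle[\mathcal H_1],[\mathcal H_3],[\mathcal H_4]\rangle\subseteq\kappa_{k^{( * )}}$. 3. If $p_2(x\pm1)$ or $2p_2(x\pm1)$ is a square in $\mathbb{N}$, then $\langle[\mathcal H_1],[\mathcal H_2],[\mathcal H_3]\rangle\subseteq\kappa_{k^{( * )}}$. 4. If $q(x\pm1)$ or $2q(x\pm1)$ is a square in $\mathbb{N}$, then $\langle[\mathcal H_1],[\mathcal H_2],[\mathcal H_3]\rangle=\langle[\mathcal H_1],[\mathcal H_2],[\mathcal H_4]\rangle\subseteq\kappa_{k^{( * )}}$.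
   Context: $i=\sqrt{-1}$. For integers $c,u$, ''$c(u\pm1)$ is a square in $\mathbb{N}$'' means at least one of $c(u+1)$, $c(u-1)$ is the square of a natural number. Write $p_1=e^2+4f^2$, $p_2=g^2+4h^2$ ($e,f,g,h\in\mathbb{N}$), $\pi_1=e+2if$, $\pi_2=e-2if$, $\pi_3=g+2ih$, $\pi_4=g-2ih$; $\mathcal H_j$ is the prime ideal of $k$ above $\pi_j$ and $[\cdot]$ denotes ideal class in $k$. The absolute genus field $k^{( * )}$ is the maximal unramified extension of $k$ that is abelian over $\mathbb{Q}$; $\kappa_{k^{( * )}}$ is the kernel of the map $\mathrm{Cl}(k)\to\mathrm{Cl}(k^{( * )})$ induced by extension of ideals. *)

(* Defs.v *)
(* Number fields are subfields of algC, represented as sets. *)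
From HB Require Import structures.
From mathcomp Require Import all_boot all_order all_algebra all_fingroup all_field.
From mathcomp Require Import boolp classical_sets.

Set Implicit Arguments.
Unset Strict Implicit.
Unset Printing Implicit Defensive.

Import Order.TTheory GRing.Theory Num.Theory.
Local Open Scope ring_scope.
Local Open Scope classical_set_scope.

(* Q(s): the predicates of type divringClosed algC are the subfields of algC. *)
Definition Qadjoin (s : seq algC) : set algC :=
  [set x | forall F : divringClosed algC, {subset s <= F} -> x \in F].

Definition abelian_over_Q (K : set algC) : Prop :=
  exists (L : splittingFieldType rat) (phi : {rmorphism L -> algC}),
    [/\ range phi = K, galois 1 {: L} & abelian 'Gal({: L} / 1)].

Definition integers (K : set algC) : set algC :=
  [set x | K x /\ x \in Aint].

Definition submodule (K I : set algC) : Prop :=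
  [/\ I `<=` K, I 0, (forall x y, I x -> I y -> I (x + y))
    & (forall a x, integers K a -> I x -> I (a * x))].

Definition ideal (K I : set algC) : Prop :=
  submodule K I /\ I `<=` integers K.

Definition fractional_ideal (K I : set algC) : Prop :=
  [/\ submodule K I, (exists2 x, I x & x != 0)
    & (exists c, [/\ integers K c, c != 0
                   & forall x, I x -> integers K (c * x)])].

Definition scale_ideal (a : algC) (I : set algC) : set algC :=
  [set a * x | x in I].

Definition principal_ideal (K : set algC) (a : algC) : set algC :=
  scale_ideal a (integers K).

Definition ideal_mul (I J : set algC) : set algC :=
  [set z | exists2 s : seq (algC * algC),
             (forall u, u \in s -> I u.1 /\ J u.2)
             & z = \sum_(u <- s) u.1 * u.2].

Definition extend_ideal (K I : set algC) : set algC :=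
  ideal_mul I (integers K).

Definition prime_ideal (K P : set algC) : Prop :=
  [/\ ideal K P, P != integers K
    & forall x y, integers K x -> integers K y -> P (x * y) -> P x \/ P y].

Definition lies_over (F P p : set algC) : Prop := P `&` integers F = p.

(* No nonzero prime P of K has ramification index > 1 over F: the square of P
   does not divide the extension to K of P `&` integers F. Residue fields are
   finite, so residue extensions are automatically separable. *)
Definition unramified_finite (F K : set algC) : Prop :=
  forall P, prime_ideal K P -> P != [set 0] ->
    ~ exists2 J, ideal K J
        & extend_ideal K (P `&` integers F) = ideal_mul (ideal_mul P P) J.

(* No real place of F becomes complex in K; every embedding of K into algC
   is the restriction of an endomorphism of algC. *)
Definition unramified_infinite (F K : set algC) : Prop :=
  forall sigma : {rmorphism algC -> algC},
    (forall x, F x -> sigma x \is Num.real) ->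
    (forall x, K x -> sigma x \is Num.real).

Definition unramified_abelian (F K : set algC) : Prop :=
  [/\ F `<=` K, abelian_over_Q K, unramified_finite F K
    & unramified_infinite F K].

Definition absolute_genus_field (F K : set algC) : Prop :=
  unramified_abelian F K /\
  forall K', unramified_abelian F K' -> K' `<=` K.

(* An ideal class is the set of its fractional ideals. *)
Definition ideal_class (K I : set algC) : set (set algC) :=
  [set scale_ideal a I | a in [set a | K a /\ a != 0]].

Definition class_group (K : set algC) : set (set (set algC)) :=
  [set ideal_class K I | I in fractional_ideal K].

Definition class_one (K : set algC) : set (set algC) :=
  ideal_class K (integers K).

Definition class_mul (c c' : set (set algC)) : set (set algC) :=
  [set ideal_mul I J | I in c & J in c'].

(* Inverse-closure is stated relationally: any inverse of c in the class group
   lies in S. *)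
Definition class_subgroup (K : set algC) (S : set (set (set algC))) : Prop :=
  [/\ S `<=` class_group K, S (class_one K),
      (forall c c', S c -> S c' -> S (class_mul c c'))
    & (forall c c', S c -> class_group K c' ->
         class_mul c c' = class_one K -> S c')].

Definition class_generated (K : set algC) (X : set (set (set algC))) :
    set (set (set algC)) :=
  [set c | forall S, class_subgroup K S -> X `<=` S -> S c].

(* The union has a single value: the class in K of the extension of any member
   of c. *)
Definition extend_class (K : set algC) (c : set (set algC)) : set (set algC) :=
  \bigcup_(I in c) ideal_class K (extend_ideal K I).

Definition capitulation_kernel (F K : set algC) : set (set (set algC)) :=
  [set c | class_group F c /\ extend_class K c = class_one K].

Definition integer_unit (F : set algC) (u : algC) : Prop :=
  integers F u /\ exists2 v, integers F v & u * v = 1.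

(* Meaningful for F real quadratic; the normalization is eps > 1. *)
Definition fundamental_unit (F : set algC) (eps : algC) : Prop :=
  [/\ integer_unit F eps, 1 < eps
    & forall u, integer_unit F u ->
        exists n : int, u = eps ^ n \/ u = - eps ^ n].

Definition square_pm (c u : int) : Prop :=
  exists n : nat, c * (u + 1) = n%:Z ^+ 2 \/ c * (u - 1) = n%:Z ^+ 2.

Definition gauss_field : set algC := Qadjoin [:: 'i].

Definition biquadratic (d : nat) : set algC := Qadjoin [:: sqrtC d%:R; 'i].

Definition prime_ideal_above (K : set algC) (z : algC) (H : set algC) : Prop :=
  prime_ideal K H /\ lies_over gauss_field H (principal_ideal gauss_field z).

(* Main.v *)
(* All four classes capitulate. The field K0 = k(sqrt p1, sqrt p2) is abelian over Q and
   unramified over k, hence contained in the genus field. In k the square of the prime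
   above pi_j is (pi_j). If u + v sqrt p is a unit of norm -1 of Q(sqrt p), where
   p = pi conj(pi), then up to the sign of u the number u + i is i pi times the square of
   a Gaussian integer, and (eps + i)^2 = 2 eps (u + i) with eps = u + v sqrt p shows that
   eps pi is a square in K0. An ideal whose square is generated by a square is principal,
   so the extension of the prime above pi to the genus field is principal. Finally, if
   q (x +- 1) or 2 q (x +- 1) is a square, then p1 p2 times a unit is a square in k, so
   that H1 H2 H3 H4 is principal and either of [H3], [H4] is determined by the other
   together with [H1] and [H2]. *)
Require Import Defs.
From HB Require Import structures.
From mathcomp Require Import all_boot all_order all_algebra all_fingroup all_field.
From mathcomp Require Import boolp classical_sets.
From mathcomp Require Import realalg ring lra zify.

Set Implicit Arguments.
Unset Strict Implicit.
Unset Printing Implicit Defensive.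

Import Order.TTheory GRing.Theory Num.Theory.
Local Open Scope ring_scope.
Local Open Scope classical_set_scope.

(** * Ideals and ideal classes *)

(** Factorisation of ideals is never invoked; integrality of elements does its work. An ideal whose
    square is the whole ring consists of elements with integral squares. A prime [H] above [pi] has
    square (pi) because x / sqrt pi is integral for each x in [H]. Cancelling an ideal from a
    product is a determinant argument over a finitely generated lattice. The genus field is known
    only through its maximality, so the obstacle is to check that K0 is unramified over k at every
    prime, those above 2 included. This works because k(sqrt p1) is also k(sqrt(- p2 q)), and p1 and
    - p2 q are both 1 modulo 4, so that (1 + sqrt n) / 2 is an algebraic integer for either radicand
    n; the same holds for p2. A unit of norm -1 exists because p is a prime congruent to 1 modulo 4:
    u^2 - p v^2 = 1 has a nontrivial solution, and descent on it ends in norm -1. The identity for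
    (eps + i)^2 then comes from eps^2 - 1 = eps (eps + conj eps) = 2 u eps. *)

Definition is_subfield (K : set algC) : Prop :=
  [/\ K 1, forall x y, K x -> K y -> K (x - y)
    & forall x y, K x -> K y -> K (x / y)].

Section Subfield.

Variable K : set algC.
Hypothesis fieldK : is_subfield K.

Lemma subfield1 : K 1. Proof. by case: fieldK. Qed.

Lemma subfieldB x y : K x -> K y -> K (x - y). Proof. by case: fieldK => _ + _; apply. Qed.

Lemma subfield_div x y : K x -> K y -> K (x / y). Proof. by case: fieldK => _ _; apply. Qed.

Lemma subfield0 : K 0. Proof. by rewrite -(subrr 1); apply: subfieldB; exact: subfield1. Qed.

Lemma subfieldN x : K x -> K (- x).
Proof. by rewrite -sub0r; apply: subfieldB; exact: subfield0. Qed.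

Lemma subfieldD x y : K x -> K y -> K (x + y).
Proof. by move=> Kx Ky; rewrite -[y]opprK; apply: subfieldB => //; exact: subfieldN. Qed.

Lemma subfieldV x : K x -> K x^-1.
Proof. by rewrite -div1r; apply: subfield_div; exact: subfield1. Qed.

Lemma subfieldM x y : K x -> K y -> K (x * y).
Proof. by move=> Kx Ky; rewrite -[y]invrK; apply: subfield_div => //; exact: subfieldV. Qed.

Lemma subfieldX x n : K x -> K (x ^+ n).
Proof. by move=> Kx; elim: n => [|n IH]; [exact: subfield1 | rewrite exprS; exact: subfieldM]. Qed.

Lemma subfield_nat n : K n%:R.
Proof. by elim: n => [|n IH]; [exact: subfield0 | rewrite -natr1; apply: subfieldD IH subfield1]. Qed.

Lemma subfield_int (n : int) : K n%:~R.
Proof.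
case: n => n; first exact: subfield_nat.
by rewrite NegzE rmorphN /=; apply: subfieldN; exact: subfield_nat.
Qed.

Lemma integers0 : integers K 0. Proof. by split; [exact: subfield0 | rewrite rpred0]. Qed.

Lemma integers1 : integers K 1. Proof. by split; [exact: subfield1 | rewrite rpred1]. Qed.

Lemma integersD x y : integers K x -> integers K y -> integers K (x + y).
Proof. by move=> [? ?] [? ?]; split; [exact: subfieldD | rewrite rpredD]. Qed.

Lemma integersB x y : integers K x -> integers K y -> integers K (x - y).
Proof. by move=> [? ?] [? ?]; split; [exact: subfieldB | rewrite rpredB]. Qed.

Lemma integersN x : integers K x -> integers K (- x).
Proof. by move=> [? ?]; split; [exact: subfieldN | rewrite rpredN]. Qed.

Lemma integersM x y : integers K x -> integers K y -> integers K (x * y).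
Proof. by move=> [? ?] [? ?]; split; [exact: subfieldM | rewrite rpredM]. Qed.

Lemma integers_int (n : int) : integers K n%:~R.
Proof. by split; [exact: subfield_int | rewrite Aint_int]. Qed.

Lemma integers_nat n : integers K n%:R.
Proof. exact: (integers_int n%:Z). Qed.

Lemma submodule_integers : submodule K (integers K).
Proof.
by split=> [x []//|||]; [exact: integers0 | exact: integersD | exact: integersM].
Qed.

End Subfield.

Lemma integers_subset (F K : set algC) : F `<=` K -> integers F `<=` integers K.
Proof. by move=> FK x [Fx xA]; split=> //; apply: FK. Qed.

Lemma mem_ideal_mul (I J : set algC) x y : I x -> J y -> ideal_mul I J (x * y).
Proof.
move=> Ix Jy; exists [:: (x, y)]; last by rewrite big_seq1.
by move=> u; rewrite inE => /eqP ->.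
Qed.

Lemma ideal_mul_min (I J M : set algC) :
  M 0 -> (forall x y, M x -> M y -> M (x + y)) ->
  (forall x y, I x -> J y -> M (x * y)) -> ideal_mul I J `<=` M.
Proof.
move=> M0 MD MIJ z [s sIJ ->]; elim: s sIJ => [|u s IH] sIJ; first by rewrite big_nil.
rewrite big_cons; apply: MD.
  by have [? ?] := sIJ u (mem_head _ _); apply: MIJ.
by apply: IH => v vs; apply: sIJ; rewrite inE vs orbT.
Qed.

Lemma ideal_mul0 I J : ideal_mul I J 0.
Proof. by exists [::]; rewrite ?big_nil. Qed.

Lemma ideal_mulD I J x y : ideal_mul I J x -> ideal_mul I J y -> ideal_mul I J (x + y).
Proof.
move=> [s sIJ ->] [t tIJ ->]; exists (s ++ t); last by rewrite big_cat.
by move=> u; rewrite mem_cat => /orP[/sIJ|/tIJ].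
Qed.

Lemma ideal_mulC I J : ideal_mul I J = ideal_mul J I.
Proof.
have sub A B : ideal_mul A B `<=` ideal_mul B A.
  apply: ideal_mul_min; [exact: ideal_mul0 | exact: ideal_mulD |].
  by move=> x y Ax By; rewrite mulrC; apply: mem_ideal_mul.
by apply/seteqP; split.
Qed.

Lemma ideal_mulA I J L : ideal_mul I (ideal_mul J L) = ideal_mul (ideal_mul I J) L.
Proof.
have sub A B C : ideal_mul A (ideal_mul B C) `<=` ideal_mul (ideal_mul A B) C.
  apply: ideal_mul_min; [exact: ideal_mul0 | exact: ideal_mulD |] => x y Ax [s sBC ->].
  exists [seq (x * u.1, u.2) | u <- s]; last first.
    by rewrite big_map mulr_sumr; apply: eq_bigr => u _; rewrite /= mulrA.
  move=> _ /mapP[u us ->] /=; have [? ?] := sBC u us.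
  by split=> //; apply: mem_ideal_mul.
apply/seteqP; split; first exact: sub.
rewrite (ideal_mulC _ L) (ideal_mulC I (ideal_mul J L)) (ideal_mulC J) (ideal_mulC I).
exact: sub.
Qed.

Lemma ideal_mulACA I J L M :
  ideal_mul (ideal_mul I J) (ideal_mul L M) = ideal_mul (ideal_mul I L) (ideal_mul J M).
Proof. by rewrite !ideal_mulA -(ideal_mulA I) (ideal_mulC J) !ideal_mulA. Qed.

Lemma ideal_mulS I J I' J' : I `<=` I' -> J `<=` J' -> ideal_mul I J `<=` ideal_mul I' J'.
Proof.
move=> sI sJ; apply: ideal_mul_min; [exact: ideal_mul0 | exact: ideal_mulD |].
by move=> x y /sI Ix /sJ Jy; apply: mem_ideal_mul.
Qed.

Lemma scale_idealA a b I : scale_ideal a (scale_ideal b I) = scale_ideal (a * b) I.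
Proof.
apply/seteqP; split=> [z [_ [x Ix <-] <-]|z [x Ix <-]].
  by exists x; rewrite ?mulrA.
by exists (b * x); [exists x | rewrite mulrA].
Qed.

Lemma scale_ideal1 I : scale_ideal 1 I = I.
Proof.
apply/seteqP; split=> [z [x Ix <-]|z Iz]; first by rewrite mul1r.
by exists z; rewrite ?mul1r.
Qed.

Lemma ideal_mul_scalel a I J : ideal_mul (scale_ideal a I) J = scale_ideal a (ideal_mul I J).
Proof.
apply/seteqP; split.
  apply: ideal_mul_min.
  - by exists 0; [exact: ideal_mul0 | rewrite mulr0].
  - move=> _ _ [x Ix <-] [y Iy <-]; exists (x + y); last by rewrite mulrDr.
    exact: ideal_mulD.
  - by move=> _ y [x Ix <-] Jy; exists (x * y); [exact: mem_ideal_mul | rewrite mulrA].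
move=> _ [_ [s sIJ ->] <-]; exists [seq (a * u.1, u.2) | u <- s].
  by move=> _ /mapP[u us ->]; have [? ?] := sIJ u us; split=> //=; exists u.1.
by rewrite big_map mulr_sumr; apply: eq_bigr => u _; rewrite mulrA.
Qed.

Lemma ideal_mul_scaler a I J : ideal_mul I (scale_ideal a J) = scale_ideal a (ideal_mul I J).
Proof. by rewrite ideal_mulC ideal_mul_scalel ideal_mulC. Qed.

Section Ideals.

Variable K : set algC.
Hypothesis fieldK : is_subfield K.
Let O := integers K.

Lemma extend_submodule I : submodule K I -> extend_ideal K I = I.
Proof.
move=> [_ I0 ID IM]; apply/seteqP; split.
  by apply: ideal_mul_min => // x y Ix Oy; rewrite mulrC; apply: IM.
by move=> x Ix; rewrite -[x]mulr1; apply: mem_ideal_mul => //; exact: integers1.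
Qed.

Lemma extend_mem I x : I x -> extend_ideal K I x.
Proof. by move=> Ix; rewrite -[x]mulr1; apply: mem_ideal_mul => //; exact: integers1. Qed.

Lemma extend_min I M : submodule K M -> I `<=` M -> extend_ideal K I `<=` M.
Proof.
move=> [_ M0 MD MM] IM; apply: ideal_mul_min => // x y /IM Mx Oy.
by rewrite mulrC; apply: MM.
Qed.

Lemma submodule_mul I J : I `<=` K -> submodule K J -> submodule K (ideal_mul I J).
Proof.
move=> IK [JK J0 JD JM]; split; [| exact: ideal_mul0 | exact: ideal_mulD |].
  apply: ideal_mul_min; [exact: subfield0 | exact: subfieldD |].
  by move=> x y /IK Kx /JK Ky; apply: subfieldM.
move=> a _ Oa [s sIJ ->]; exists [seq (u.1, a * u.2) | u <- s].
  by move=> _ /mapP[u us ->]; have [? ?] := sIJ u us; split=> //=; apply: JM.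
by rewrite big_map mulr_sumr; apply: eq_bigr => u _; rewrite mulrCA.
Qed.

Lemma submodule_scale a I : K a -> submodule K I -> submodule K (scale_ideal a I).
Proof.
move=> Ka [IK I0 ID IM]; split.
- by move=> _ [x Ix <-]; apply: subfieldM => //; apply: IK.
- by exists 0; rewrite ?mulr0.
- by move=> _ _ [x Ix <-] [y Iy <-]; exists (x + y); rewrite ?mulrDr //; apply: ID.
- by move=> b _ Ob [x Ix <-]; exists (b * x); [apply: IM | rewrite mulrCA].
Qed.

Lemma submodule_extend I : I `<=` K -> submodule K (extend_ideal K I).
Proof. by move=> IK; apply: submodule_mul => //; exact: submodule_integers. Qed.

Lemma extend_scale a I : extend_ideal K (scale_ideal a I) = scale_ideal a (extend_ideal K I).
Proof. exact: ideal_mul_scalel. Qed.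

Lemma extend_mul I J :
  extend_ideal K (ideal_mul I J) = ideal_mul (extend_ideal K I) (extend_ideal K J).
Proof.
have OO : ideal_mul O O = O by apply: extend_submodule; exact: submodule_integers.
by rewrite /extend_ideal -/O -[in LHS]OO ideal_mulACA.
Qed.

Lemma submodule_eq_integers I : submodule K I -> I `<=` O -> I 1 -> I = O.
Proof.
move=> [_ _ _ IM] IO I1; apply/seteqP; split=> // x Ox.
by rewrite -[x]mulr1; apply: IM.
Qed.

End Ideals.

(** Substituting X^2 in the minimal polynomial of x^2 gives a monic integral polynomial with root
    x. *)
Lemma Aint_sqrt x : x ^+ 2 \in Aint -> x \in Aint.
Proof.
move=> x2A.
apply: (@root_monic_Aint (minCpoly (x ^+ 2) \Po 'X^2)).
- by rewrite /root horner_comp hornerXn; exact: root_minCpoly.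
- rewrite monicE lead_coef_comp ?size_polyXn // lead_coefXn expr1n mulr1.
  by rewrite -monicE minCpoly_monic.
- by rewrite polyOver_comp // rpredX // polyOverX.
Qed.

(** Dividing by [a] reduces to a module [J] with J J = O. Each x in [J] then has an integral square,
    so [J] lies in O, and from 1 in J J follows 1 in [J]. *)
Lemma square_principal K a I : is_subfield K -> a != 0 -> submodule K I ->
  K a -> ideal_mul I I = principal_ideal K (a ^+ 2) -> I = principal_ideal K a.
Proof.
move=> fK a0 subI Ka II.
have EI : I = scale_ideal a (scale_ideal a^-1 I).
  by rewrite scale_idealA divff // scale_ideal1.
rewrite EI; congr (scale_ideal a _); set J := scale_ideal a^-1 I.
have subJ : submodule K J by apply: submodule_scale => //; apply: subfieldV.
have JJ : ideal_mul J J = integers K.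
  rewrite ideal_mul_scalel ideal_mul_scaler II scale_idealA scale_idealA.
  by rewrite -expr2 -exprMn mulVf // expr1n scale_ideal1.
have JO : J `<=` integers K.
  move=> x Jx; split; first by case: subJ => + _ _ _; apply.
  apply: Aint_sqrt; rewrite expr2.
  by have: ideal_mul J J (x * x) by [apply: mem_ideal_mul]; rewrite JJ => -[].
apply: submodule_eq_integers => //.
have: ideal_mul J J 1 by rewrite JJ; apply: integers1.
have [_ J0 JD JM] := subJ.
by apply: ideal_mul_min => // x y /JO Ox Jy; apply: JM.
Qed.

Section Classes.

Variable K : set algC.
Hypothesis fieldK : is_subfield K.

Lemma ideal_class_scale a I : K a -> a != 0 ->
  ideal_class K (scale_ideal a I) = ideal_class K I.
Proof.
move=> Ka a0; apply/seteqP; split=> _ [b [Kb b0] <-].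
  by exists (b * a); [split; [exact: subfieldM | rewrite mulf_neq0] | rewrite scale_idealA].
exists (b / a); last by rewrite scale_idealA divfK.
by split; [exact: subfield_div | rewrite mulf_neq0 ?invr_neq0].
Qed.

Lemma class_principal a : K a -> a != 0 ->
  ideal_class K (principal_ideal K a) = class_one K.
Proof. exact: ideal_class_scale. Qed.

Lemma class_mulE I J :
  class_mul (ideal_class K I) (ideal_class K J) = ideal_class K (ideal_mul I J).
Proof.
apply/seteqP; split.
  move=> _ [_ [a [Ka a0] <-] [_ [b [Kb b0] <-] <-]].
  exists (a * b); first by split; [exact: subfieldM | rewrite mulf_neq0].
  by rewrite ideal_mul_scalel ideal_mul_scaler scale_idealA.
move=> _ [a [Ka a0] <-]; exists (scale_ideal a I); first by exists a.
exists J; last by rewrite ideal_mul_scalel.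
exists 1; last by rewrite scale_ideal1.
by split; [exact: subfield1 | rewrite oner_eq0].
Qed.

Lemma fractional_integers : fractional_ideal K (integers K).
Proof.
split; first exact: submodule_integers.
  by exists 1; [exact: integers1 | rewrite oner_eq0].
exists 1; split; [exact: integers1 | by rewrite oner_eq0 |].
by move=> x; rewrite mul1r.
Qed.

Lemma fractional_mul I J :
  fractional_ideal K I -> fractional_ideal K J -> fractional_ideal K (ideal_mul I J).
Proof.
move=> [sI [x Ix x0] [c [Oc c0 cI]]] [sJ [y Jy y0] [b [Ob b0 bJ]]]; split.
- by apply: submodule_mul => //; case: sI.
- by exists (x * y); [exact: mem_ideal_mul | rewrite mulf_neq0].
exists (c * b); split; [exact: integersM | by rewrite mulf_neq0 |].
apply: (@ideal_mul_min _ _ [set z | integers K (c * b * z)]).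
- by rewrite /= mulr0; exact: integers0.
- by move=> u v /= Ou Ov; rewrite mulrDr; exact: integersD.
- by move=> u v Iu Jv /=; rewrite mulrACA; apply: integersM => //; [exact: cI | exact: bJ].
Qed.

Lemma class_group_one : class_group K (class_one K).
Proof. by exists (integers K) => //; exact: fractional_integers. Qed.

Lemma class_group_mul c c' : class_group K c -> class_group K c' -> class_group K (class_mul c c').
Proof.
move=> [I fI <-] [J fJ <-]; exists (ideal_mul I J); first exact: fractional_mul.
by rewrite class_mulE.
Qed.

Lemma class_generated_eq X Y :
  (forall S, class_subgroup K S -> X `<=` S <-> Y `<=` S) ->
  class_generated K X = class_generated K Y.
Proof.
by move=> XY; apply/seteqP; split=> c cX S sS YS; apply: cX => //; apply/XY.
Qed.

End Classes.

Lemma class_mulC c c' : class_mul c c' = class_mul c' c.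
Proof.
by apply/seteqP; split=> _ [I Ic [J Jc <-]]; exists J => //; exists I => //; rewrite ideal_mulC.
Qed.

Lemma class_mulA c c' c'' : class_mul c (class_mul c' c'') = class_mul (class_mul c c') c''.
Proof.
apply/seteqP; split=> [_ [I cI [_ [J cJ [L cL <-] <-]]]|_ [_ [I cI [J cJ <-] [L cL <-]]]].
  by exists (ideal_mul I J); [exists I => //; exists J | exists L; rewrite ?ideal_mulA].
by exists I => //; exists (ideal_mul J L); [exists J => //; exists L | rewrite ideal_mulA].
Qed.

Section Extension.

Variables F K : set algC.
Hypotheses (fieldF : is_subfield F) (fieldK : is_subfield K) (subFK : F `<=` K).

Lemma extend_classE I : extend_class K (ideal_class F I) = ideal_class K (extend_ideal K I).
Proof.
apply/seteqP; split.
  move=> J [_ [a [Fa a0] <-]]; rewrite extend_scale ideal_class_scale //.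
  exact: subFK.
move=> J IJ; exists I => //; exists 1; last by rewrite scale_ideal1.
by split; [exact: subfield1 | rewrite oner_eq0].
Qed.

Lemma extend_integers : extend_ideal K (integers F) = integers K.
Proof.
apply/seteqP; split.
  apply: extend_min; first exact: submodule_integers.
  exact: integers_subset.
move=> x Ox; rewrite -[x]mul1r; apply: mem_ideal_mul => //; exact: integers1.
Qed.

Lemma extend_principal a : extend_ideal K (principal_ideal F a) = principal_ideal K a.
Proof. by rewrite /principal_ideal extend_scale extend_integers. Qed.

Lemma extend_class_mul c c' : class_group F c -> class_group F c' ->
  extend_class K (class_mul c c') = class_mul (extend_class K c) (extend_class K c').
Proof. by move=> [I _ <-] [J _ <-]; rewrite class_mulE // !extend_classE extend_mul // class_mulE. Qed.

Lemma capitulation_kernel_subgroup : class_subgroup F (capitulation_kernel F K).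
Proof.
(* An extended ideal is already a module over the integers of [K], so the unit class acts trivially
   on its class. *)
have one_mul c : class_group F c ->
    class_mul (class_one K) (extend_class K c) = extend_class K c.
  move=> [I [sI _ _] <-]; rewrite extend_classE class_mulE //; congr ideal_class.
  rewrite ideal_mulC; apply: extend_submodule => //; apply: submodule_extend => //.
  by move=> x Ix; apply: subFK; case: sI => + _ _ _; apply.
have ext1 : extend_class K (class_one F) = class_one K.
  by rewrite extend_classE extend_integers.
split.
- by move=> c [].
- by split; [exact: class_group_one | ].
- move=> c c' [Fc ec] [Fc' ec']; split; first exact: class_group_mul.
  by rewrite extend_class_mul // ec ec' class_mulE //; congr ideal_class;
    apply: extend_submodule => //; exact: submodule_integers.
- move=> c c' [Fc ec] Fc' cc'; split=> //.
  by rewrite -one_mul // -ec -extend_class_mul // cc' ext1 ec.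
Qed.

Lemma class_generated_capitulates X :
  X `<=` capitulation_kernel F K -> class_generated F X `<=` capitulation_kernel F K.
Proof. by move=> XK c; apply=> //; exact: capitulation_kernel_subgroup. Qed.

End Extension.

(** * Multiquadratic fields *)

(** [Qadjoin] quantifies over bundled boolean predicates; deciding membership in [K] classically
    turns [K] into one of them. *)
Lemma Qadjoin_sub s K : is_subfield K -> (forall a, a \in s -> K a) -> Qadjoin s `<=` K.
Proof.
move=> fK sK x; pose S := fun z => `[<K z>].
have clS : divring_closed S.
  split=> [|y z /asboolP Ky /asboolP Kz|y z /asboolP Ky /asboolP Kz]; apply/asboolP.
  - exact: subfield1.
  - exact: subfieldB.
  - exact: subfield_div.
pose mS := GRing.isDivringClosed.Build algC S clS.
pose F : divringClosed algC := HB.pack S mS.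
move=> /(_ F) xF; apply/asboolP; apply: xF => a as_; apply/asboolP; exact: sK.
Qed.

Lemma Qadjoin_subfield s : is_subfield (Qadjoin s).
Proof.
by split=> [F _|x y xF yF F sF|x y xF yF F sF];
  rewrite ?rpred1 ?rpredB ?rpred_div ?xF ?yF.
Qed.

Lemma Qadjoin_mem s a : a \in s -> Qadjoin s a.
Proof. by move=> as_ F; apply. Qed.

Lemma Qadjoin_cons_sub a s : Qadjoin s `<=` Qadjoin (a :: s).
Proof.
apply: Qadjoin_sub => [|b bs]; first exact: Qadjoin_subfield.
by apply: Qadjoin_mem; rewrite inE bs orbT.
Qed.

Lemma Qadjoin_cons_id a s : Qadjoin s a -> Qadjoin (a :: s) = Qadjoin s.
Proof.
move=> sa; apply/seteqP; split; last exact: Qadjoin_cons_sub.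
apply: Qadjoin_sub => [|b]; first exact: Qadjoin_subfield.
by rewrite inE => /orP[/eqP->//|/Qadjoin_mem].
Qed.

(** Closure under division rationalises the denominator: as 1 and [a] are independent over [F], the
    norm u'^2 - v'^2 a^2 of a nonzero element is nonzero. *)
Lemma quadratic_subfield F a : is_subfield F -> ~ F a -> F (a ^+ 2) ->
  is_subfield [set x | exists u v, [/\ F u, F v & x = u + v * a]].
Proof.
move=> fF nFa Fa2.
have lin0 u v : F u -> F v -> u + v * a = 0 -> u = 0 /\ v = 0.
  move=> Fu Fv uv0; have [v0|v0] := eqVneq v 0.
    by split=> //; move: uv0; rewrite v0 mul0r addr0.
  case: nFa; have -> : a = - u / v by rewrite -(mulfK v0 a) mulrC (mulrC a) -[u](addrK (v * a)) uv0 sub0r opprK mulrC.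
  by apply: subfield_div => //; apply: subfieldN.
split.
- exists 1, 0; split; [exact: subfield1 | exact: subfield0 | by rewrite mul0r addr0].
- move=> _ _ [u [v [Fu Fv ->]]] [u' [v' [Fu' Fv' ->]]].
  by exists (u - u'), (v - v'); split; [exact: subfieldB | exact: subfieldB | ring].
move=> _ _ [u [v [Fu Fv ->]]] [u' [v' [Fu' Fv' ->]]].
have [u'v'|nz] := eqVneq (u' + v' * a) 0.
  rewrite u'v' invr0 mulr0; exists 0, 0.
  by split; [exact: subfield0 | exact: subfield0 | rewrite mul0r addr0].
pose n := u' ^+ 2 - v' ^+ 2 * a ^+ 2.
have nE : n = (u' + v' * a) * (u' - v' * a) by rewrite /n; ring.
have n0 : n != 0.
  rewrite nE mulf_neq0 //; apply: contraNneq nz => um.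
  have [|-> /eqP] := lin0 u' (- v') Fu' (subfieldN fF Fv'); first by rewrite mulNr.
  by rewrite oppr_eq0 => /eqP->; rewrite mul0r addr0.
have Fn : F n.
  by apply: subfieldB => //; [exact: subfieldX | apply: subfieldM => //; exact: subfieldX].
exists ((u * u' - v * v' * a ^+ 2) / n), ((v * u' - u * v') / n); split.
- apply: subfield_div => //; apply: subfieldB => //; first exact: subfieldM.
  by apply: subfieldM => //; exact: subfieldM.
- by apply: subfield_div => //; apply: subfieldB => //; exact: subfieldM.
apply: (mulIf nz); rewrite divfK //; transitivity ((u + v * a) * n / n); first by rewrite mulfK.
by move: (n^-1) => w; rewrite /n; ring.
Qed.

Lemma Qadjoin_quadratic s a x : Qadjoin s (a ^+ 2) -> Qadjoin (a :: s) x ->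
  exists u v, [/\ Qadjoin s u, Qadjoin s v & x = u + v * a].
Proof.
have fF := Qadjoin_subfield s; move=> Fa2.
have [Fa|nFa] := pselect (Qadjoin s a).
  rewrite Qadjoin_cons_id // => Fx; exists x, 0.
  by split=> //; [exact: (subfield0 fF) | rewrite mul0r addr0].
suff: Qadjoin (a :: s) `<=` [set x | exists u v, [/\ Qadjoin s u, Qadjoin s v & x = u + v * a]].
  exact.
apply: Qadjoin_sub; first exact: quadratic_subfield.
move=> b; rewrite inE => /orP[/eqP->|bs].
  by exists 0, 1; split; [exact: (subfield0 fF) | exact: (subfield1 fF) | rewrite add0r mul1r].
by exists b, 0; split; [exact: Qadjoin_mem | exact: (subfield0 fF) | rewrite mul0r addr0].
Qed.

(** If b = u + v a has its square in the base field, the cross term 2 u v a lies there too; hence v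
    = 0, or u = 0, or [a] itself is in the base field. *)
Lemma quadratic_sqrt s a b : Qadjoin s (a ^+ 2) -> Qadjoin s (b ^+ 2) ->
  Qadjoin (a :: s) b -> Qadjoin s b \/ Qadjoin s (b * a).
Proof.
have fF := Qadjoin_subfield s; move=> Fa2 Fb2 Fab.
have [u [v [Fu Fv bE]]] := Qadjoin_quadratic Fa2 Fab.
have [v0|v0] := eqVneq v 0; first by left; rewrite bE v0 mul0r addr0.
have [u0|u0] := eqVneq u 0.
  by right; rewrite bE u0 add0r -mulrA -expr2; exact: (subfieldM fF).
have Fa : Qadjoin s a.
  have -> : a = (b ^+ 2 - u ^+ 2 - v ^+ 2 * a ^+ 2) / (2 * u * v).
    apply: (@mulIf _ (2 * u * v)); first by rewrite !mulf_neq0 ?pnatr_eq0.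
    by rewrite divfK ?mulf_neq0 ?pnatr_eq0 // bE; ring.
  apply: (subfield_div fF) => //.
    apply: (subfieldB fF) => //; last by apply: (subfieldM fF) => //; exact: (subfieldX fF).
    by apply: (subfieldB fF) => //; exact: (subfieldX fF).
  by apply: (subfieldM fF) => //; apply: (subfieldM fF) => //; exact: (subfield_nat fF).
by left; rewrite Qadjoin_cons_id // in Fab.
Qed.

(** * Automorphisms of fields generated by square roots *)

Section NumberField.

Variables (L : fieldExtType rat) (phi : {rmorphism L -> algC}).

Lemma adjoin_range (E : {subfield L}) (s : seq L) (K : set algC) : is_subfield K ->
  (forall x, x \in E -> K (phi x)) -> (forall x, x \in s -> K (phi x)) ->
  forall x, x \in <<E & s>>%VS -> K (phi x).
Proof.
move=> fK; elim: s E => [|a s IH] E EK sK; first by rewrite Fadjoin_nil.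
rewrite adjoin_cons; apply: (IH <<E; a>>%AS); last first.
  by move=> b bs; apply: sK; rewrite inE bs orbT.
move=> x /Fadjoin_polyP[p pE ->]; rewrite -horner_map /=.
elim/poly_ind: p pE => [|p c IHp] pE; first by rewrite rmorph0 horner0; exact: subfield0.
have cE : c \in E by move/polyOverP: pE => /(_ 0); rewrite coefD coefMX add0r coefC eqxx.
have {}pE : p \is a polyOver E.
  by apply/polyOverP=> i; move/polyOverP: pE => /(_ i.+1); rewrite coefD coefMX coefC addr0.
rewrite rmorphD rmorphM /= map_polyX map_polyC !hornerE.
apply: subfieldD => //; last exact: EK.
by apply: subfieldM => //; [exact: IHp | apply: sK; rewrite mem_head].
Qed.

Lemma number_field_subfield : is_subfield (range phi).
Proof.
split; first by exists 1; rewrite ?rmorph1.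
- by move=> _ _ [x _ <-] [y _ <-]; exists (x - y); rewrite ?rmorphB.
- by move=> _ _ [x _ <-] [y _ <-]; exists (x / y); rewrite ?fmorph_div.
Qed.

Lemma alg1_range (K : set algC) : is_subfield K -> forall x, x \in 1%AS -> K (phi x).
Proof.
move=> fK x /vlineP[c ->]; rewrite alg_num_field fmorph_rat.
by rewrite /ratr; apply: subfield_div => //; exact: subfield_int.
Qed.

Lemma Qadjoin_range s : <<1 & s>>%VS = fullv -> range phi = Qadjoin (map phi s).
Proof.
move=> gens; apply/seteqP; split.
  move=> _ [x _ <-]; apply: (@adjoin_range 1%AS s _ (Qadjoin_subfield _)).
  - exact: alg1_range (Qadjoin_subfield _).
  - by move=> a sa; apply: Qadjoin_mem; apply: map_f.
  - by rewrite /= gens memvf.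
apply: Qadjoin_sub; first exact: number_field_subfield.
by move=> _ /mapP[x _ ->]; exists x.
Qed.

End NumberField.

(** The conjugation is wanted on all of [algC], where it preserves algebraic integers. On a number
    field [L] = [E]([b]), with [b] mapping to [a] and [E] to Q(s), it extends the identity of [E] by
    sending [b] to the other root of its minimal polynomial; it is then extended to [algC]. *)
Lemma quadratic_conjugation s a : Qadjoin s (a ^+ 2) -> ~ Qadjoin s a ->
  exists nu : {rmorphism algC -> algC}, (forall x, Qadjoin s x -> nu x = x) /\ nu a = - a.
Proof.
move=> Fa2 nFa; have [L [phi [t Dt gent]]] := num_field_exists (rcons s a).
have [t' [b Et]] : exists t' b, t = rcons t' b.
  by case/lastP: t Dt {gent} => [|t' b _]; [case: (s) | exists t', b].
move: Dt gent; rewrite {}Et map_rcons adjoin_rcons => /rcons_inj[Dt Db] gent.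
pose E := <<1 & t'>>%AS.
have EF x : x \in E -> Qadjoin s (phi x).
  apply: (@adjoin_range _ _ 1%AS); first exact: Qadjoin_subfield.
    exact: alg1_range (Qadjoin_subfield _).
  by move=> y yt; rewrite -Dt; apply: Qadjoin_mem; apply: map_f.
have FE x : Qadjoin s x -> exists2 y, y \in E & phi y = x.
  have fE : is_subfield [set phi y | y in [set y | y \in E]].
    split; first by exists 1; rewrite ?rmorph1 //= mem1v.
    - by move=> _ _ [u Eu <-] [v Ev <-]; exists (u - v); rewrite ?rmorphB //= rpredB.
    - by move=> _ _ [u Eu <-] [v Ev <-]; exists (u / v); rewrite ?fmorph_div //= rpred_div.
  apply: (Qadjoin_sub fE) => c; rewrite -Dt => /mapP[y yt ->]; exists y => //=.
  exact: seqv_sub_adjoin.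
have nEb : b \notin E by apply/negP => /EF; rewrite Db.
have Eb2 : b ^+ 2 \in E.
  by have [y Ey yE] := FE _ Fa2; suff <- : y = b ^+ 2 by []; apply: (fmorph_inj phi); rewrite rmorphXn /= Db.
(* The minimal polynomial divides X^2 - b^2, and it is not linear because [b] is not in [E]. *)
have minb : minPoly E b = 'X^2 - (b ^+ 2)%:P.
  have dvd : minPoly E b %| 'X^2 - (b ^+ 2)%:P.
    apply: minPoly_dvdp; first by rewrite rpredB ?rpredX ?polyOverX ?polyOverC.
    by rewrite /root !hornerE subrr.
  have := monic_minPoly E b; rewrite !monicE => /eqP mon.
  apply/eqP; rewrite -eqp_monic ?monic_minPoly ?monicXnsubC // -dvdp_size_eqp //.
  rewrite eqn_leq dvdp_leq ?monic_neq0 ?monicXnsubC // size_XnsubC // size_minPoly ltnS.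
  by rewrite ltn_neqAle eq_sym adjoin_deg_eq1 nEb.
pose f := kHomExtend E \1 b (- b).
have homE : kHom E E (\1%VF : 'End(L)) by rewrite kHom1.
have rootb : root (map_poly \1%VF (minPoly E b)) (- b).
  by rewrite lfun1_poly minb /root !hornerE sqrrN subrr.
have fm : monoid_morphism f.
  apply/kHom_monoid_morphism; rewrite -gent.
  exact: (kHomSl (sub1v E) (kHomExtendP (subvv E) homE rootb)).
pose fmM := GRing.isMonoidMorphism.Build _ _ f fm.
pose fRM : {rmorphism L -> L} := HB.pack (fun_of_lfun f) fmM.
have [nu Dnu] := extend_algC_subfield_aut phi fRM.
exists nu; split=> [x /FE[y Ey <-]|].
  by rewrite -Dnu /= /f kHomExtend_id // id_lfunE.
by rewrite -Db -Dnu /= /f (kHomExtend_val homE) // rmorphN.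
Qed.

(** An automorphism sends each generator to itself or to its negative, so two of them commute on the
    generators; the elements on which they commute form a subfield. *)
Lemma abelian_over_Q_multiquadratic s : (forall a, a \in s -> a ^+ 2 \in Crat) ->
  abelian_over_Q (Qadjoin s).
Proof.
move=> s2; have [L0 [phi [t Dt gent]]] := num_field_exists s.
have t2 a : a \in t -> a ^+ 2 \in 1%VS.
  move=> ta; have /s2 : phi a \in s by rewrite -Dt map_f.
  rewrite -rmorphXn => /CratP[c cE]; apply/vlineP; exists c; apply: (fmorph_inj phi).
  by rewrite alg_num_field fmorph_rat -cE.
have split_L : splitting_field_axiom L0.
  exists (\prod_(a <- t) ('X^2 - (a ^+ 2)%:P)).
    rewrite big_seq rpred_prod // => a ta.
    by rewrite rpredB ?rpredX ?polyOverX ?polyOverC //; exact: t2.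
  exists (t ++ map -%R t).
    rewrite big_cat big_map /= -big_split /=.
    rewrite (eq_bigr (fun a => ('X - a%:P) * ('X - (- a)%:P))) ?eqpxx // => a _.
    by rewrite rmorphN opprK rmorphXn /=; ring.
  apply/eqP; rewrite eqEsubv subvf -gent.
  apply/Fadjoin_seqP; split; first exact: subv_adjoin_seq.
  by move=> a ta; apply: seqv_sub_adjoin; rewrite mem_cat ta.
pose mL := FieldExt_isSplittingField.Build rat L0 split_L.
pose L : splittingFieldType rat := HB.pack L0 mL.
exists L, phi; split; first by rewrite -Dt; exact: Qadjoin_range.
  apply/and3P; split; [exact: sub1v | | exact: normalFieldf].
  apply/separableP => x _; apply: pcharf0_separable => p.
  by rewrite pchar_lalg pchar_num.
apply/centsP => sg _ tau _.
have galt (r : gal_of {:L}) a : a \in t -> r a = a \/ r a = - a.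
  move=> ta; apply/pred2P; rewrite -eqf_sqr -rmorphXn /=.
  by have /vlineP[c ->] := t2 a ta; rewrite linearZ /= rmorph1.
apply/eqP/gal_eqP => x _; rewrite !galM ?memvf //.
have fK : is_subfield [set phi z | z in [set z : L | tau (sg z) = sg (tau z)]].
  split; first by exists 1; rewrite /= ?rmorph1.
  - move=> _ _ [u /= Eu <-] [v /= Ev <-]; exists (u - v); last by rewrite rmorphB.
    by rewrite /= !rmorphB /= Eu Ev.
  - move=> _ _ [u /= Eu <-] [v /= Ev <-]; exists (u / v); last by rewrite fmorph_div.
    by rewrite /= !fmorph_div /= Eu Ev.
have := @adjoin_range _ phi 1%AS t _ fK (alg1_range phi fK) _ x.
rewrite /= gent memvf => /(_ _ isT)[a ta|z zE /fmorph_inj<-//].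
exists a => //=; case: (galt sg a ta) (galt tau a ta) => E1 [] E2;
  by rewrite ?E1 ?E2 ?rmorphN /= ?E1 ?E2.
Qed.

(** * Lattices and ramification *)

Definition zspan (B : seq algC) : set algC :=
  [set x | exists n : nat -> int, x = \sum_(i < size B) (n i)%:~R * B`_i].

Lemma zspan_nil x : zspan [::] x -> x = 0.
Proof. by move=> [n ->]; rewrite big_ord0. Qed.

Lemma zspan_cons b B x :
  zspan (b :: B) x <-> exists (n : int) y, zspan B y /\ x = n%:~R * b + y.
Proof.
split=> [[n ->]|[m [_ [[n ->] ->]]]].
  exists (n 0%N), (\sum_(i < size B) (n i.+1)%:~R * B`_i).
  by split; [exists (fun i => n i.+1) | rewrite big_ord_recl].
by exists (fun i => if i is j.+1 then n j else m); rewrite big_ord_recl.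
Qed.

Lemma zspan0 B : zspan B 0.
Proof. by exists (fun=> 0); rewrite big1 // => i _; rewrite mul0r. Qed.

Lemma zspanD B x y : zspan B x -> zspan B y -> zspan B (x + y).
Proof.
move=> [n ->] [m ->]; exists (fun i => n i + m i); rewrite -big_split.
by apply: eq_bigr => i _; rewrite rmorphD mulrDl.
Qed.

Lemma zspanZ B (k : int) x : zspan B x -> zspan B (k%:~R * x).
Proof.
move=> [n ->]; exists (fun i => k * n i); rewrite mulr_sumr.
by apply: eq_bigr => i _; rewrite rmorphM mulrA.
Qed.

Lemma zspan_map B a x : zspan B x -> zspan [seq a * b | b <- B] (a * x).
Proof.
move=> [n ->]; exists n; rewrite size_map mulr_sumr; apply: eq_bigr => i _.
by rewrite (nth_map 0) // mulrCA.
Qed.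

Lemma zspan_cat B C x y : zspan B x -> zspan C y -> zspan (B ++ C) (x + y).
Proof.
elim: B x => [|b B IH] x; first by move=> /zspan_nil->; rewrite add0r.
move=> /zspan_cons[n [z [Bz ->]]] Cy; rewrite -addrA; apply/zspan_cons.
by exists n, (z + y); split=> //; exact: IH.
Qed.

Lemma subgroup_intmul (A : set algC) : A 0 -> (forall x y, A x -> A y -> A (x - y)) ->
  forall (k : int) x, A x -> A (k%:~R * x).
Proof.
move=> A0 AB k x Ax.
have AN y : A y -> A (- y) by rewrite -sub0r; exact: AB.
have An n : A (n%:R * x).
  elim: n => [|n IH]; first by rewrite mul0r.
  by rewrite -natr1 mulrDl mul1r -[x in _ + x]opprK; apply: AB => //; exact: AN.
case: k => n; first exact: An.
by rewrite NegzE rmorphN mulNr; apply: AN; exact: An.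
Qed.

(** The coefficients of [b] that occur in [A] are the multiples of the least positive one. One
    element of [A] with this coefficient, together with generators of the part of [A] inside
    [zspan B], generates [A]. *)
Lemma zspan_subgroup_fg B (A : set algC) : A 0 -> (forall x y, A x -> A y -> A (x - y)) ->
  A `<=` zspan B -> exists2 C, (forall c, c \in C -> A c) & A `<=` zspan C.
Proof.
elim: B A => [|b B IH] A A0 AB sAB; first by exists [::].
have [C CA AC] : exists2 C, (forall c, c \in C -> A c /\ zspan B c)
    & (A `&` zspan B) `<=` zspan C.
  apply: IH; [by split=> //; exact: zspan0 | | by move=> x []].
  move=> x y [Ax Bx] [Ay By]; split; first exact: AB.
  by apply: zspanD => //; have := zspanZ (-1) By; rewrite mulN1r.
pose N (n : nat) := `[< (0 < n)%N /\ exists2 y, zspan B y & A (n%:R * b + y) >].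
have [exN|noN] := pselect (exists n, N n); last first.
  (* No positive coefficient occurs, hence by change of sign no nonzero one, and [A] already lies in
     [zspan B]. *)
  exists C => [c /CA[]//|x Ax]; apply: AC; split=> //.
  have /zspan_cons[n [y [By xE]]] := sAB x Ax.
  have [n0|n0] := eqVneq n 0; first by rewrite xE n0 mul0r add0r.
  case: noN; exists `|n|%N; apply/asboolP; split; first by rewrite absz_gt0.
  case: (n) n0 xE => m n0 xE; first by exists y; rewrite -?xE.
  exists (- y); first by have := zspanZ (-1) By; rewrite mulN1r.
  have -> : `|Negz m|%N%:R * b - y = - x by rewrite xE NegzE rmorphN /=; ring.
  by rewrite -sub0r; exact: AB.
have [n /asboolP[n_gt0 [y By An]] minn] := ex_minnP exN.
exists ((n%:R * b + y) :: C).
  by move=> c; rewrite inE => /orP[/eqP->//|/CA[]].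
move=> x Ax; have /zspan_cons[m [z [Bz xE]]] := sAB x Ax.
have mE := divz_eq m n%:Z; set k := (m %/ n)%Z in mE; set r := (m %% n)%Z in mE.
have r_ge0 : 0 <= r by apply: modz_ge0; lia.
have r_lt : r < n%:Z by apply: ltz_pmod; lia.
have Bzk : zspan B (z - k%:~R * y).
  by apply: zspanD => //; have := zspanZ (- k) By; rewrite rmorphN mulNr.
have Axk : A (x - k%:~R * (n%:R * b + y)) by apply: (AB) Ax _; exact: (subgroup_intmul A0 AB).
have xkE : x - k%:~R * (n%:R * b + y) = r%:~R * b + (z - k%:~R * y).
  by rewrite xE mE rmorphD rmorphM /=; ring.
(* A nonzero remainder would be a positive coefficient smaller than [n]. *)
have r0 : r = 0.
  case: (r) r_ge0 r_lt xkE => // j _ jn xkE; congr Posz; apply/eqP.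
  rewrite -leqn0 leqNgt; apply/negP=> j_gt0.
  have : N j by apply/asboolP; split=> //; exists (z - k%:~R * y); rewrite // -xkE.
  by move/minn; lia.
apply/zspan_cons; exists k, (z - k%:~R * y); split; last first.
  by rewrite xE mE r0 addr0 rmorphM /=; ring.
by apply: AC; split=> //; rewrite xkE r0 mul0r add0r in Axk.
Qed.

(** For x = u + v a the first three elements are 2 u, u^2 - v^2 a^2 and 2 v a^2. The factor [a] in
    the third brings the difference x - nu x back into the base field and preserves integrality when
    [a] is integral. *)
Lemma quadratic_trace_norm s a (nu : {rmorphism algC -> algC}) x : Qadjoin s (a ^+ 2) ->
  (forall y, Qadjoin s y -> nu y = y) -> nu a = - a -> Qadjoin (a :: s) x ->
  [/\ Qadjoin s (x + nu x), Qadjoin s (x * nu x), Qadjoin s ((x - nu x) * a)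
    & Qadjoin (a :: s) (nu x)].
Proof.
have fF := Qadjoin_subfield s; have fK := Qadjoin_subfield (a :: s).
move=> Fa2 nuF nua /(Qadjoin_quadratic Fa2)[u [v [Fu Fv ->]]].
rewrite rmorphD rmorphM /= nua !nuF //; split.
- have -> : u + v * a + (u + v * - a) = u + u by ring.
  exact: (subfieldD fF).
- have -> : (u + v * a) * (u + v * - a) = u ^+ 2 - v ^+ 2 * a ^+ 2 by ring.
  apply: (subfieldB fF); first exact: (subfieldX fF).
  by apply: (subfieldM fF) => //; exact: (subfieldX fF).
- have -> : (u + v * a - (u + v * - a)) * a = (v + v) * a ^+ 2 by ring.
  by apply: (subfieldM fF) => //; exact: (subfieldD fF).
- apply: (subfieldD fK); first exact: Qadjoin_cons_sub.
  apply: (subfieldM fK); first exact: Qadjoin_cons_sub.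
  by apply: (subfieldN fK); apply: Qadjoin_mem; rewrite mem_head.
Qed.

(** Each x is (x + nu x) / 2 + (x - nu x) a / (2 a), where both numerators are integers of the
    smaller field. So a lattice for that field, scaled by 1 / 2 and by 1 / (2 a), suffices. *)
Lemma integers_lattice s : (forall a, a \in s -> exists2 n : int, n != 0 & a ^+ 2 = n%:~R) ->
  exists B, integers (Qadjoin s) `<=` zspan B.
Proof.
elim: s => [|a s IH] sq.
  exists [:: 1] => x [Qx xA].
  have : x \in Crat.
    move: x Qx {xA}; apply: (@Qadjoin_sub [::] [set x | x \in Crat]) => //.
    split=> [|x y /= ? ?|x y /= ? ?]; [exact: rpred1 | exact: rpredB | exact: rpred_div].
  move=> /Cint_rat_Aint /(_ xA) /intrP[n ->].
  by apply/zspan_cons; exists n, 0; split; [exact: zspan0 | rewrite mulr1 addr0].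
have [|B OB] := IH; first by move=> b bs; apply: sq; rewrite inE bs orbT.
have [Fa|nFa] := pselect (Qadjoin s a); first by exists B; rewrite Qadjoin_cons_id.
have [n n0 a2E] := sq a (mem_head _ _).
have aA : a \in Aint by apply: Aint_sqrt; rewrite a2E Aint_int.
have Fa2 : Qadjoin s (a ^+ 2) by rewrite a2E; apply: subfield_int (Qadjoin_subfield s) _.
have a0 : a != 0 by rewrite -sqrf_eq0 a2E intr_eq0.
have [nu [nuF nua]] := quadratic_conjugation Fa2 nFa.
exists ([seq 2^-1 * b | b <- B] ++ [seq (2 * a)^-1 * b | b <- B]) => x [Kx xA].
have [Ft _ Fg _] := quadratic_trace_norm Fa2 nuF nua Kx.
have nuxA : nu x \in Aint by rewrite Aint_aut.
have -> : x = 2^-1 * (x + nu x) + (2 * a)^-1 * ((x - nu x) * a).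
  rewrite invfM -mulrA (mulrC a^-1) -mulrA divff // mulr1 -mulrDr addrACA subrr addr0.
  by rewrite -mulr2n -(mulr_natl x) mulrA mulVf ?pnatr_eq0 // mul1r.
apply: zspan_cat; apply: zspan_map; apply: OB; split=> //; first by rewrite rpredD.
by rewrite rpredM ?rpredB.
Qed.

(** * Cancellation of ideals by determinants *)

Section DeterminantTrick.

Variables (K P : set algC).
Hypotheses (fieldK : is_subfield K) (primeP : prime_ideal K P).

Lemma prime_ideal_mulr x y : P x -> integers K y -> P (x * y).
Proof. by case: primeP => -[[_ _ _ PM] _] _ _ Px Oy; rewrite mulrC; exact: PM. Qed.

Lemma prime_idealD x y : P x -> P y -> P (x + y).
Proof. by case: primeP => -[[_ _ PD _] _] _ _; exact: PD. Qed.

Lemma prime_idealN x : P x -> P (- x).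
Proof.
move=> Px; rewrite -mulrN1; apply: prime_ideal_mulr => //.
by apply: integersN => //; exact: integers1.
Qed.

Lemma prime_ideal_integers x : P x -> integers K x.
Proof. by case: primeP => -[_ + _] _; apply. Qed.

Lemma prime_ideal0 : P 0. Proof. by case: primeP => -[[]]. Qed.

Lemma prime_ideal_exp x n : integers K x -> P (x ^+ n) -> P x.
Proof.
have [[[_ _ _ PM] PO] PneO Pprime] := primeP.
move=> Ox; elim: n => [|n IH].
  move=> P1; case/negP: PneO; apply/eqP/seteqP; split=> // y Oy.
  by rewrite -[y]mulr1; exact: PM.
rewrite exprS => /Pprime[] //; by split; [apply: subfieldX | apply: rpredX]; case: Ox.
Qed.

(** Only the identity permutation contributes modulo [P]: any other one picks an off-diagonal entry,
    which lies in [P]. *)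
Lemma determinant_mod n (A : 'M[algC]_n) D : integers K D -> (forall i j, P (A i j)) ->
  P (\det (D%:M - A) - D ^+ n).
Proof.
move=> OD PA.
have OX m : integers K (D ^+ m).
  by split; [apply: subfieldX | apply: rpredX]; case: OD.
rewrite /determinant (bigD1 1%g) //= odd_perm1 expr0 mul1r addrAC.
have Psum (I : Type) (r : seq I) (Q : pred I) (F : I -> algC) :
    (forall i, Q i -> P (F i)) -> P (\sum_(i <- r | Q i) F i).
  by move=> PF; apply: big_ind => //; [exact: prime_ideal0 | exact: prime_idealD].
have Oprod (I : Type) (r : seq I) (Q : pred I) (F : I -> algC) :
    (forall i, Q i -> integers K (F i)) -> integers K (\prod_(i <- r | Q i) F i).
  by move=> PF; apply: big_ind => //; [exact: integers1 | move=> *; exact: integersM].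
have OA i j : integers K ((D%:M - A) i j).
  rewrite !mxE; apply: integersB => //; last by apply: prime_ideal_integers; exact: PA.
  by case: (i == j); rewrite ?mulr1n ?mulr0n //; exact: integers0.
apply: prime_idealD.
  under eq_bigr do rewrite perm1 !mxE eqxx mulr1n.
  have -> : D ^+ n = \prod_(i < n) D by rewrite prodr_const card_ord.
  elim: (index_enum _) => [|i r IH]; first by rewrite !big_nil subrr; exact: prime_ideal0.
  rewrite !big_cons; set v := \prod_(j <- r) D in IH *;
    set u := \prod_(j <- r) (D - A j j) in IH *.
  have -> : (D - A i i) * u - D * v = (u - v) * D - A i i * u by ring.
  apply: prime_idealD; first exact: prime_ideal_mulr.
  apply: prime_idealN; apply: prime_ideal_mulr => //; apply: Oprod => j _.
  by have := OA j j; rewrite !mxE eqxx mulr1n.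
apply: Psum => sg sg1; have [i sgi] : exists i, sg i != i.
  apply/existsP; rewrite -negb_forall; apply: contra sg1 => /forallP E.
  by apply/eqP/permP => i; rewrite perm1; exact/eqP.
rewrite mulrC; apply: prime_ideal_mulr; last first.
  by case: (odd_perm sg); rewrite ?expr1 ?expr0; [apply: integersN => // |]; exact: integers1.
rewrite (bigD1 i) //=; apply: prime_ideal_mulr; last exact: Oprod.
by rewrite !mxE eq_sym (negbTE sgi) mulr0n sub0r; exact: prime_idealN.
Qed.

(** This cancels [M] from the inclusion of D M in P M. Writing D c_i as a combination of the c_j
    with coefficients in [P] makes the nonzero vector of generators a kernel vector of D - A; the
    determinant vanishes, and modulo [P] it is a power of [D]. *)
Lemma determinant_trick (M : set algC) (C : seq algC) D : integers K D ->
  (exists2 c, c \in C & c != 0) -> M `<=` zspan C ->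
  (forall c, c \in C -> ideal_mul P M (D * c)) -> P D.
Proof.
move=> OD [c0 c0C c0n0] MC DC; set n := size C.
have PMrow x : ideal_mul P M x ->
    exists f : 'rV[algC]_n, (forall j, P (f 0 j)) /\ x = \sum_(j < n) f 0 j * C`_j.
  move: x; apply: ideal_mul_min.
  - exists 0; split=> [j|]; first by rewrite mxE; exact: prime_ideal0.
    by rewrite big1 // => j _; rewrite mxE mul0r.
  - move=> x y [f [Pf ->]] [g [Pg ->]]; exists (f + g); split=> [j|].
      by rewrite mxE; exact: prime_idealD.
    by rewrite -big_split; apply: eq_bigr => j _; rewrite mxE mulrDl.
  move=> x y Px /MC[m ->]; exists (\row_j (x * (m j)%:~R)); split=> [j|].
    by rewrite mxE; apply: prime_ideal_mulr => //; exact: integers_int.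
  by rewrite mulr_sumr; apply: eq_bigr => j _; rewrite mxE mulrA.
have /choice[f fP] : forall i : 'I_n, exists f : 'rV[algC]_n,
    (forall j, P (f 0 j)) /\ D * C`_i = \sum_(j < n) f 0 j * C`_j.
  by move=> i; apply: PMrow; apply: DC; exact: mem_nth.
pose A := \matrix_i f i.
have det0 : \det (D%:M - A) = 0.
  apply/eqP; rewrite -det_tr; apply/det0P; exists (\row_j C`_j).
    apply/eqP => /rowP E; have iC : (index c0 C < n)%N by rewrite index_mem.
    by case/eqP: c0n0; have := E (Ordinal iC); rewrite !mxE /= nth_index.
  apply/rowP => i; rewrite !mxE.
  have [_ fE] := fP i; under eq_bigr do rewrite !mxE mulrBr.
  rewrite sumrB (bigD1 i) //= eqxx mulr1n big1 ?addr0; last first.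
    by move=> j ji; rewrite eq_sym (negbTE ji) mulr0n mulr0.
  by rewrite mulrC fE; apply/eqP; rewrite subr_eq0; apply/eqP/eq_bigr => j _; rewrite mulrC.
apply: (@prime_ideal_exp D n) => //; rewrite -[D ^+ n]opprK; apply: prime_idealN.
rewrite -[- _]add0r -[X in P (X - _)]det0; apply: determinant_mod => // i j.
by rewrite mxE; have [+ _] := fP i; exact.
Qed.

End DeterminantTrick.

Lemma Qadjoin_eq s t : s =i t -> Qadjoin s = Qadjoin t.
Proof.
move=> st; apply/seteqP; split; apply: Qadjoin_sub (Qadjoin_subfield _) _ => a.
  by rewrite st; exact: Qadjoin_mem.
by rewrite -st; exact: Qadjoin_mem.
Qed.

(* The trace of [P J] lands in [p = P `&` integers F], because squares of elements of
   [P J] lie in the Galois stable ideal generated by [p]; pairing with the elements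
   [(1 + d1) / 2] and [(1 + d2) / 2] then shows [d1 d2 P J] to be inside
   [p O = P (P J)], and the determinant trick cancels [P J]. *)
Lemma ramified_different s a b d1 d2 r1 r2 P J :
  (forall c, c \in [:: b, a & s] -> exists2 n : int, n != 0 & c ^+ 2 = n%:~R) ->
  ~ Qadjoin (b :: s) a -> ~ Qadjoin (a :: s) b ->
  prime_ideal (Qadjoin [:: b, a & s]) P -> P != [set 0] -> ideal (Qadjoin [:: b, a & s]) J ->
  extend_ideal (Qadjoin [:: b, a & s]) (P `&` integers (Qadjoin s))
    = ideal_mul (ideal_mul P P) J ->
  Qadjoin s r1 -> Qadjoin s r2 -> d1 = r1 * a -> d2 = r2 * b ->
  (1 + d1) / 2 \in Aint -> (1 + d2) / 2 \in Aint -> P (d1 * d2).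
Proof.
set K := Qadjoin [:: b, a & s]; set F := Qadjoin s.
move=> sq nFa nFb primeP P0 idJ ram Fr1 Fr2 d1E d2E th1A th2A.
have fF : is_subfield F by exact: Qadjoin_subfield.
have fK : is_subfield K by exact: Qadjoin_subfield.
have FK : F `<=` K by move=> x Fx; do 2!apply: Qadjoin_cons_sub.
have sqF t c : c \in [:: b, a & s] -> Qadjoin t (c ^+ 2).
  by move=> /sq[n _ ->]; apply: subfield_int (Qadjoin_subfield _) _.
have Ka : K a by apply: Qadjoin_mem; rewrite !inE eqxx orbT.
have Kb : K b by apply: Qadjoin_mem; rewrite !inE eqxx.
have asq : a \in [:: b, a & s] by rewrite !inE eqxx orbT.
have bsq : b \in [:: b, a & s] by rewrite !inE eqxx.
have [sg [sgF sga]] := quadratic_conjugation (sqF _ _ asq) nFa.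
have [tau [tauF taub]] := quadratic_conjugation (sqF _ _ bsq) nFb.
have sgid x : F x -> sg x = x by move=> Fx; apply: sgF; exact: Qadjoin_cons_sub.
have tauid x : F x -> tau x = x by move=> Fx; apply: tauF; exact: Qadjoin_cons_sub.
have sgb : sg b = b by apply: sgF; apply: Qadjoin_mem; rewrite mem_head.
have taua : tau a = a by apply: tauF; apply: Qadjoin_mem; rewrite mem_head.
have KE : K = Qadjoin [:: a, b & s].
  by apply: Qadjoin_eq => c; rewrite !inE orbCA.
have sgK x : K x -> K (sg x).
  by rewrite KE => Kx; have [] := quadratic_trace_norm (sqF _ _ asq) sgF sga Kx.
have tauK x : K x -> K (tau x).
  by move=> Kx; have [] := quadratic_trace_norm (sqF _ _ bsq) tauF taub Kx.
have sgO x : integers K x -> integers K (sg x) by move=> [Kx xA]; split; rewrite ?Aint_aut //; exact: sgK.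
have tauO x : integers K x -> integers K (tau x) by move=> [Kx xA]; split; rewrite ?Aint_aut //; exact: tauK.
(* This is the trace from [K] to [F], the sum over the four automorphisms 1, [tau], [sg] and [sg]
   [tau]. *)
pose Tr x := x + tau x + sg (x + tau x).
have TrF x : K x -> F (Tr x).
  move=> Kx; have [Ft _ _ _] := quadratic_trace_norm (sqF _ _ bsq) tauF taub Kx.
  by have [] := quadratic_trace_norm (sqF s _ asq) sgid sga Ft.
have PN := prime_ideal_mulr primeP.
have [[[_ _ _ PM] PO] PneO Pprime] := primeP; have [[JK J0 JD JM] JO] := idJ.
set p := P `&` integers F in ram.
pose A := ideal_mul P J.
have PK : P `<=` K by move=> x /PO[].
have subA : submodule K A by apply: submodule_mul => //; case: idJ.
have [_ A0 AD AM] := subA.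
have PA : ideal_mul P A = extend_ideal K p by rewrite ram ideal_mulA.
have AO : A `<=` integers K.
  apply: ideal_mul_min; [exact: integers0 | exact: integersD |].
  by move=> x y /PO Ox /JO Oy; exact: integersM.
have pK_stable (g : {rmorphism algC -> algC}) : (forall x, F x -> g x = x) ->
    (forall x, integers K x -> integers K (g x)) ->
    forall x, extend_ideal K p x -> extend_ideal K p (g x).
  move=> gF gO x [t tp ->]; rewrite rmorph_sum.
  exists [seq (u.1, g u.2) | u <- t].
    by move=> _ /mapP[u ut ->]; have [? ?] := tp u ut; split=> //=; exact: gO.
  rewrite big_map big_seq [RHS]big_seq; apply: eq_bigr => u ut.
  by have [[_ [Fu _]] _] := tp u ut; rewrite rmorphM /= gF.
have pKP : extend_ideal K p `<=` P.
  by apply: extend_min => [|x []//]; case: primeP => -[].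
have sqA z : A z -> extend_ideal K p (z ^+ 2).
  move=> Az; rewrite -PA expr2; have := mem_ideal_mul Az Az.
  apply: ideal_mulS => // y; apply: ideal_mul_min; [exact: prime_ideal0 primeP | exact: prime_idealD primeP |].
  by move=> u v Pu /JO Ov; exact: PN.
have AP z : A z -> P z.
  by move=> Az; apply: (prime_ideal_exp fK primeP (n := 2)); [exact: AO | exact/pKP/sqA].
(* [P] need not be stable under [g], but the extension of [p] is: g(z)^2 = g(z^2) lies in it, hence
   in [P], and [P] is prime. *)
have gA (g : {rmorphism algC -> algC}) : (forall x, F x -> g x = x) ->
    (forall x, integers K x -> integers K (g x)) -> forall z, A z -> P (g z).
  move=> gF gO z Az; apply: (prime_ideal_exp fK primeP (n := 2)); first exact/gO/AO.
  by rewrite -rmorphXn; apply: pKP; apply: pK_stable => //; exact: sqA.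
have TrA z : A z -> p (Tr z).
  move=> Az; have PTr : P (Tr z).
    rewrite /Tr rmorphD /=; apply: (prime_idealD primeP); apply: (prime_idealD primeP).
    - exact: AP.
    - exact: gA.
    - exact: gA.
    - apply: (gA (sg \o tau)) => // x; first by move=> Fx /=; rewrite tauid ?sgid.
      by move=> Ox /=; exact/sgO/tauO.
  split=> //; split; last by case: (PO _ PTr).
  by apply: TrF; case: (AO _ Az).
have K2 : K 2 by exact: (subfield_nat fK 2).
have Od1 : K d1 by rewrite d1E; apply: (subfieldM fK) => //; exact: FK.
have Od2 : K d2 by rewrite d2E; apply: (subfieldM fK) => //; exact: FK.
pose th1 := (1 + d1) / 2; pose th2 := (1 + d2) / 2.
have Oth1 : integers K th1.
  split=> //; apply: (subfield_div fK) => //; apply: (subfieldD fK) => //; exact: subfield1.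
have Oth2 : integers K th2.
  split=> //; apply: (subfield_div fK) => //; apply: (subfieldD fK) => //; exact: subfield1.
have sgd1 : sg d1 = - d1 by rewrite d1E rmorphM /= sga sgid // mulrN.
have taud1 : tau d1 = d1 by rewrite d1E rmorphM /= taua tauid.
have sgd2 : sg d2 = d2 by rewrite d2E rmorphM /= sgb sgid.
have taud2 : tau d2 = - d2 by rewrite d2E rmorphM /= taub tauid // mulrN.
have sg1 : sg th1 = 1 - th1.
  rewrite /th1 fmorph_div rmorphD rmorph1 rmorph_nat /= sgd1.
  by field.
have tau1 : tau th1 = th1 by rewrite /th1 fmorph_div rmorphD rmorph1 rmorph_nat /= taud1.
have sg2 : sg th2 = th2 by rewrite /th2 fmorph_div rmorphD rmorph1 rmorph_nat /= sgd2.
have tau2 : tau th2 = 1 - th2.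
  rewrite /th2 fmorph_div rmorphD rmorph1 rmorph_nat /= taud2.
  by field.
have dth1 : d1 = th1 - (1 - th1).
  by rewrite /th1; field.
have dth2 : d2 = th2 - (1 - th2).
  by rewrite /th2; field.
clearbody th1 th2; have O1 := integers1 fK.
have OB := @integersB K fK; have OM := @integersM K fK.
(* The identity expands the sum over the four automorphisms g of g(x) (g(th1) - (1 - th1)) (g(th2) -
   (1 - th2)). Since [sg] sends th1 to 1 - th1 and [tau] sends th2 to 1 - th2, only the term of g =
   1 survives, and it is d1 d2 x. *)
have DA x : A x -> extend_ideal K p (d1 * d2 * x).
  move=> Ax; have -> : d1 * d2 * x = Tr (th1 * (th2 * x)) * 1 + Tr (th1 * x) * - (1 - th2)
      + Tr (th2 * x) * - (1 - th1) + Tr x * ((1 - th1) * (1 - th2)).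
    rewrite /Tr !(rmorphD, rmorphM) /= ?(rmorphM, tau1, tau2, sg1, sg2, rmorphB, rmorph1) /=.
    by rewrite ?(tau1, tau2, sg1, sg2, rmorphB, rmorph1) dth1 dth2; ring.
  have ON := @integersN K fK.
  by apply: ideal_mulD; [apply: ideal_mulD; [apply: ideal_mulD|]|]; apply: mem_ideal_mul => //;
    do ?[apply: (TrA) | apply: (AM) | apply: (ON) | apply: (OM) | apply: (OB)].
have Od : integers K (d1 * d2) by rewrite dth1 dth2; apply: (OM); apply: (OB) => //; exact: OB.
have [B OKB] := integers_lattice sq.
have [||C CA AC] := zspan_subgroup_fg (B := B) A0 (A := A).
- move=> x y Ax Ay; apply: AD => //; rewrite -mulN1r; apply: AM => //.
  exact: integersN.
- by move=> x /AO /OKB.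
apply: (determinant_trick fK primeP Od _ AC); last first.
  by move=> c /CA Ac; rewrite PA; exact: DA.
(* A nonzero generator is required. The norm to [F] of a nonzero element of [P] lies in [p], hence
   in P A and in [A], so [A] is not zero. *)
have [z Pz z0] : exists2 z, P z & z != 0.
  apply: contrapT => noz; case/negP: P0; apply/eqP/seteqP; split=> z; last first.
    by move=> /= ->; exact: prime_ideal0 primeP.
  by move=> Pz; have [//|z0] := eqVneq z 0; case: noz; exists z.
pose w := z * tau z; pose N := w * sg w.
have Oz := PO _ Pz.
have Ow : integers K w by apply: OM => //; exact: tauO.
have Nn0 : N != 0 by rewrite /N /w !(mulf_neq0, fmorph_eq0).
have pN : p N.
  have [_ Fw _ _] := quadratic_trace_norm (sqF _ _ bsq) tauF taub (PK _ Pz).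
  have [_ FN _ _] := quadratic_trace_norm (sqF s _ asq) sgid sga Fw.
  have PNN : P N by apply: (PN); [apply: (PN) => //; exact: tauO | exact: sgO].
  by split=> //; split=> //; case: (PO _ PNN).
have AN : A N.
  have: extend_ideal K p N by exact: extend_mem.
  rewrite -PA; apply: ideal_mul_min => // x y /PO Ox Ay; exact: AM.
apply: contrapT => noc; case/negP: Nn0; apply/eqP.
have [n ->] := AC N AN; rewrite big1 // => i _.
have [->|ci] := eqVneq C`_i 0; first by rewrite mulr0.
by case: noc; exists C`_i; rewrite ?mem_nth.
Qed.

(** * Primes above Gaussian primes *)

(** This is transitivity of integrality; the coefficients are passed to [integralOver] through their
    minimal polynomials. *)
Lemma Aint_root_monic (p : {poly algC}) y :
  p \is monic -> root p y -> (forall c, c \in (p : seq algC) -> c \in Aint) -> y \in Aint.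
Proof.
have intA x : x \in Aint -> integralOver (intr : int -> algC) x.
  move=> /floorpP[q qE]; exists q; last by rewrite -qE root_minCpoly.
  have := minCpoly_monic x; rewrite qE !monicE lead_coef_map_inj //; last exact: intr_inj.
  by move=> /eqP E; apply/eqP; apply: (@intr_inj algC).
move=> mon_p py pA; have [q mon_q qy] : integralOver (intr : int -> algC) y.
  by apply: integral_root_monic mon_p py _ => c /pA; exact: intA.
apply: root_monic_Aint qy _ _; first by rewrite monic_map.
by apply/polyOverP => i; rewrite coef_map intr_int.
Qed.

Lemma Aint_quadratic t n y : t \in Aint -> n \in Aint -> y ^+ 2 = t * y - n -> y \in Aint.
Proof.
move=> tA nA yE; have polyE : polyseq (Poly [:: n; - t; 1]) = [:: n; - t; 1].
  by apply: (@PolyK _ 0); rewrite oner_eq0.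
apply: (@Aint_root_monic (Poly [:: n; - t; 1])).
- by rewrite monicE /lead_coef polyE.
- rewrite /root horner_Poly /=; apply/eqP.
  have -> : ((0 * y + 1) * y + - t) * y + n = y ^+ 2 - (t * y - n) by ring.
  by rewrite yE subrr.
- by move=> c; rewrite polyE !inE => /or3P[]/eqP->; rewrite ?rpredN.
Qed.

(** The number is a root of Y^2 - Y - n. *)
Lemma Aint_half c (n : int) : c ^+ 2 = (1 + 4 * n)%:~R -> (1 + c) / 2 \in Aint.
Proof.
move=> c2; apply: (@Aint_quadratic 1 (- n%:~R)); rewrite ?rpredN ?Aint_int ?rpred1 //.
by rewrite expr_div_n sqrrD c2 rmorphD rmorphM /=; field.
Qed.

Lemma prime_ideal_not1 K P : is_subfield K -> prime_ideal K P -> ~ P 1.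
Proof.
move=> fK [[[_ _ _ PM] PO] PneO _] P1; case/negP: PneO; apply/eqP/seteqP; split=> // y Oy.
by rewrite -[y]mulr1; exact: PM.
Qed.

(* For [x] in [H], the trace and norm of [x] over Q(i) are divisible by [pi], so that
   [x / sqrt pi] is integral. *)
Lemma prime_above_square w pi c u v (H : set algC) :
  let G := integers gauss_field in
  let k := Qadjoin [:: w; 'i] in
  w ^+ 2 = pi * c -> ~ gauss_field w -> G pi -> G c -> G u -> G v -> pi != 0 ->
  u * pi + v * c = 1 -> prime_ideal_above k pi H ->
  ideal_mul H H = principal_ideal k pi.
Proof.
move=> G k w2 nFw Gpi Gc Gu Gv pi0 upvc [primeH overH].
have fG : is_subfield gauss_field := Qadjoin_subfield _.
have fk : is_subfield k := Qadjoin_subfield _.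
have Gk : gauss_field `<=` k by exact: Qadjoin_cons_sub.
have Fw2 : gauss_field (w ^+ 2).
  by rewrite w2; apply: (subfieldM fG); [case: Gpi | case: Gc].
have [nu [nuF nuw]] := quadratic_conjugation Fw2 nFw.
have [[[Hk H0 HD HM] HO] HneO Hprime] := primeH.
have HG x : H x -> G x -> exists2 y, G y & x = pi * y.
  move=> Hx Gx; have : (H `&` G) x by [].
  by rewrite overH => -[y Gy <-]; exists y.
have Hpi : H pi.
  suff : (H `&` G) pi by case.
  by rewrite overH; exists 1; [exact: integers1 | rewrite mulr1].
have OG x : G x -> integers k x by exact: integers_subset.
have wA : w \in Aint.
  by apply: Aint_sqrt; rewrite w2; apply: rpredM; [case: Gpi | case: Gc].
have Ow : integers k w by split=> //; apply: Qadjoin_mem; rewrite mem_head.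
have Hw : H w.
  apply: (prime_ideal_exp fk primeH (n := 2)) => //; rewrite w2.
  by apply: (prime_ideal_mulr primeH) => //; exact: OG.
have nHc : ~ H c.
  move=> Hc; apply: (prime_ideal_not1 fk primeH); rewrite -upvc.
  by apply: HD; apply: HM => //; exact: OG.
(* With trace pi t' and norm pi n' of x, the quotient y = x / sqrt pi satisfies y^2 = t' sqrt pi y -
   n'. *)
have sqrt_int x : H x -> x / sqrtC pi \in Aint.
  move=> Hx; have Ox := HO _ Hx; have [Kx xA] := Ox.
  have nuxA : nu x \in Aint by rewrite Aint_aut.
  have [Ft Fn Fg Kn] := quadratic_trace_norm Fw2 nuF nuw Kx.
  have Onu : integers k (nu x) by split.
  have [n' Gn' nE] : exists2 n', G n' & x * nu x = pi * n'.
    apply: HG; first exact: prime_ideal_mulr primeH _ _ Hx Onu.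
    by split=> //; exact: rpredM.
  have [g' Gg' gE] : exists2 g', G g' & (x - nu x) * w = pi * g'.
    apply: HG; last by split=> //; rewrite rpredM ?rpredB.
    by apply: HM => //; exact: integersB.
  have Gt : G (x + nu x) by split=> //; rewrite rpredD.
  have Gn : G (x * nu x) by split=> //; rewrite rpredM.
  (* Stability of [H] under [nu] is not at hand, so the trace is reached through the discriminant.
     By this equation, and as [c] is not in [H], trace^2 - 4 norm lies in [H]; so does the norm,
     hence the trace. *)
  have eq1 : c * ((x + nu x) ^+ 2 - 4 * (x * nu x)) = pi * g' ^+ 2.
    apply: (mulfI pi0); rewrite [pi * (c * _)]mulrA -w2.
    have -> : pi * (pi * g' ^+ 2) = (pi * g') ^+ 2 by ring.
    by rewrite -gE; ring.
  have O4 : integers k 4 by exact: integers_nat.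
  have Otn : integers k ((x + nu x) ^+ 2 - 4 * (x * nu x)).
    apply: (integersB fk); last by apply: (integersM fk) => //; exact: OG.
    by rewrite expr2; apply: (integersM fk); exact: OG.
  have Htn : H ((x + nu x) ^+ 2 - 4 * (x * nu x)).
    have : H (c * ((x + nu x) ^+ 2 - 4 * (x * nu x))).
      rewrite eq1; apply: (prime_ideal_mulr primeH) => //.
      by rewrite expr2; apply: (integersM fk); exact: OG.
    by case/Hprime => //; exact: OG.
  have Ht : H (x + nu x).
    apply: (prime_ideal_exp fk primeH (n := 2)); first exact: OG.
    rewrite -[_ ^+ 2](subrK (4 * (x * nu x))); apply: HD => //.
    by apply: HM => //; apply: (prime_ideal_mulr primeH).
  have [t' Gt' tE] := HG _ Ht Gt.
  have sp0 : sqrtC pi != 0 by rewrite sqrtC_eq0.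
  have spA : sqrtC pi \in Aint by apply: Aint_sqrt; rewrite sqrtCK; case: Gpi.
  apply: (@Aint_quadratic (t' * sqrtC pi) n').
  - by rewrite rpredM //; case: Gt'.
  - by case: Gn'.
  apply: (mulIf pi0); rewrite expr_div_n sqrtCK divfK //.
  have -> : (t' * sqrtC pi * (x / sqrtC pi) - n') * pi = pi * t' * x - pi * n'.
    by rewrite -mulrA (mulrC (sqrtC pi)) divfK //; ring.
  by rewrite -tE -nE; ring.
have Kpi : k pi by apply: Gk; case: Gpi.
apply/seteqP; split.
  apply: ideal_mul_min.
  - by exists 0; [exact: integers0 | rewrite mulr0].
  - move=> _ _ [x Ox <-] [y Oy <-]; exists (x + y); last by rewrite mulrDr.
    exact: integersD.
  move=> x y Hx Hy; exists (x * y / pi); last by rewrite mulrC divfK.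
  split; first by apply: (subfield_div fk) => //; apply: (subfieldM fk); exact: Hk.
  have -> : x * y / pi = (x / sqrtC pi) * (y / sqrtC pi).
    by rewrite -{1}[pi]sqrtCK expr2 invfM; ring.
  by rewrite rpredM ?sqrt_int.
have [HHk HH0 HHD HHM] : submodule k (ideal_mul H H) by apply: submodule_mul => //; case: primeH => -[].
move=> _ [x Ox <-]; rewrite mulrC; apply: (HHM) => //.
(* Multiplying u pi + v c = 1 by [pi] and using w^2 = pi c exhibits [pi] as an element of the square
   of [H]. *)
have -> : pi = u * (pi * pi) + v * (w * w) by rewrite -expr2 -[w * w]/(w ^+ 2) w2 -[LHS]mul1r -upvc; ring.
by apply: HHD; (apply: HHM; first exact: OG); exact: mem_ideal_mul.
Qed.

(** * Unramifiedness of k(sqrt p1, sqrt p2) over k *)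

(** By [quadratic_sqrt], each generator is either dropped or multiplied into [b], and the mask
    records the choice. At the end a rational algebraic integer remains, so the accumulated product
    is a perfect square. *)
Lemma multiquadratic_sqrt (s : seq algC) (ns : seq int) b (n : int) :
  [seq a ^+ 2 | a <- s] = [seq m%:~R | m <- ns] -> b ^+ 2 = n%:~R -> Qadjoin s b ->
  exists (bs : bitseq) (k : nat), n * \prod_(m <- mask bs ns) m = k%:Z ^+ 2.
Proof.
elim: s ns b n => [|a s IH] [|m ns] // b n.
  move=> _ b2 Qb; have : b \in Crat.
    move: b Qb {b2}; apply: (@Qadjoin_sub [::] [set x | x \in Crat]) => //.
    split=> [|x y /= ? ?|x y /= ? ?]; [exact: rpred1 | exact: rpredB | exact: rpred_div].
  have bA : b \in Aint by apply: Aint_sqrt; rewrite b2 Aint_int.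
  move=> /Cint_rat_Aint /(_ bA) /intrP[j bE]; exists [::], `|j|%N.
  apply: (@intr_inj algC); rewrite big_nil mulr1 -b2 bE -rmorphXn /=; congr intr.
  by rewrite abszE -[LHS]ger0_norm ?sqr_ge0 // normrX.
move=> [a2 s2] b2 Qb.
have sqQ (j : int) : Qadjoin s j%:~R by apply: subfield_int (Qadjoin_subfield s) j.
case: (quadratic_sqrt (s := s) (a := a) (b := b)); rewrite ?a2 ?b2 //.
  by move=> /IH-/(_ _ _ s2 b2)[bs [k kE]]; exists (false :: bs), k.
move=> /IH-/(_ _ (n * m) s2)[]; first by rewrite exprMn b2 a2 rmorphM.
by move=> bs [k kE]; exists (true :: bs), k; rewrite big_cons mulrA.
Qed.

Lemma logn_square l (N : int) (k : nat) : N = k%:Z ^+ 2 -> ~~ odd (logn l `|N|).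
Proof. by move=> ->; rewrite abszX lognX mul2n odd_double. Qed.

Lemma logn_primes_neq p q : prime p -> prime q -> p <> q -> logn p q = 0%N.
Proof. by move=> pp pq pneq; rewrite logn_prime //; case: eqP. Qed.

Lemma sqr_i : ('i : algC) ^+ 2 = (-1)%:~R.
Proof. by rewrite sqrCi. Qed.

Lemma sqrtC_natK n : sqrtC n%:R ^+ 2 = (n%:Z)%:~R :> algC.
Proof. by rewrite sqrtCK. Qed.

Section Independence.

Variables p r q : nat.
Hypotheses (p_pr : prime p) (r_pr : prime r) (q_pr : prime q).
Hypotheses (pr : p <> r) (pq : p <> q) (rq : r <> q).

Let pos := (prime_gt0 p_pr, prime_gt0 r_pr, prime_gt0 q_pr).

Lemma logn_d : logn q (p * r * q) = 1%N.
Proof.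
rewrite !lognM ?muln_gt0 ?pos // (logn_primes_neq q_pr p_pr (nesym pq)).
by rewrite (logn_primes_neq q_pr r_pr (nesym rq)) logn_prime // eqxx.
Qed.

(** Otherwise, up to sign, p r^b1 (p r q)^b2 is a square with exponents b1, b2 in {0, 1}. The
    exponent of q is odd when b2 = 1, that of p when b2 = 0. *)
Lemma sqrt_prime_indep : ~ Qadjoin [:: sqrtC r%:R; sqrtC (p * r * q)%:R; 'i] (sqrtC p%:R).
Proof.
move=> /(@multiquadratic_sqrt _ [:: r%:Z; (p * r * q)%:Z; -1] _ p%:Z).
case; rewrite /= ?sqr_i ?sqrtC_natK //; move=> bs [k kE].
have [b1 [b2 NE]] : exists b1 b2 : bool,
    absz (p%:Z * \prod_(m <- mask bs [:: r%:Z; (p * r * q)%:Z; -1]) m)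
    = (p * ((if b1 then r else 1) * (if b2 then p * r * q else 1)))%N.
  (* Entries 0 and 1 of the mask select r and p r q, missing entries counting as false; the entry
     for -1 affects only the sign. *)
  exists (nth false bs 0), (nth false bs 1); rewrite abszM; congr (_ * _)%N.
  by case: bs {kE} => [|[] [|[] [|[] bs]]] /=; rewrite ?mask0 ?mask_false ?(big_cons, big_nil) ?abszM /= ?mul1n ?muln1.
case: b2 NE => NE.
  have b1_gt0 : (0 < if b1 then r else 1)%N by case: (b1); rewrite ?pos.
  have := logn_square q kE; rewrite NE [logn q (p * (_ * _))]lognM ?muln_gt0 ?b1_gt0 ?pos //.
  rewrite [logn q (_ * (p * r * q))]lognM ?muln_gt0 ?b1_gt0 ?pos // logn_d.
  rewrite (logn_primes_neq q_pr p_pr (nesym pq)).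
  by case: (b1); rewrite ?logn1 ?(logn_primes_neq q_pr r_pr (nesym rq)).
have := logn_square p kE; rewrite NE muln1 lognM ?pos //; last by case: (b1); rewrite ?pos.
rewrite (logn_prime _ p_pr) eqxx.
by case: (b1); rewrite ?logn1 ?(logn_primes_neq p_pr r_pr).
Qed.

Lemma sqrt_d_notin_gauss : ~ gauss_field (sqrtC (p * r * q)%:R).
Proof.
move=> /(@multiquadratic_sqrt _ [:: -1] _ (p * r * q)%:Z).
case; rewrite /= ?sqr_i ?sqrtC_natK //; move=> bs [k kE].
have NE : absz ((p * r * q)%:Z * \prod_(m <- mask bs [:: -1]) m) = (p * r * q)%N.
  rewrite abszM; case: bs {kE} => [|[] bs] /=; rewrite ?mask0 ?mask_false ?(big_cons, big_nil) ?abszM /= ?muln1 //.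
by have := logn_square q kE; rewrite NE logn_d.
Qed.

End Independence.

Lemma prime_ideal_coprime K P (a b : int) : is_subfield K -> prime_ideal K P ->
  coprimez a b -> P a%:~R -> P b%:~R -> False.
Proof.
move=> fK primeP /eqP ab Pa Pb; apply: (prime_ideal_not1 fK primeP).
have [u [v uv]] := Bezoutz a b; have := congr1 (intr : int -> algC) uv.
rewrite ab rmorphD !rmorphM /= => E; rewrite -[1]/(1%:~R) -E.
apply: (prime_idealD primeP); rewrite mulrC; apply: (prime_ideal_mulr primeP) => //;
  exact: integers_int.
Qed.

(* The discriminants of the quadratic extensions of [k] generated by [sqrt p1] and by
   [sqrt (- p2 q)], which coincide, are coprime, and likewise for [sqrt p2]. *)
Lemma multiquadratic_unramified (p1 p2 q : nat) :
  prime p1 -> prime p2 -> prime q -> p1 <> p2 -> p1 <> q -> p2 <> q ->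
  (p1%:Z = 1 %[mod 4])%Z -> (p2%:Z = 1 %[mod 4])%Z -> (- q%:Z = 1 %[mod 4])%Z ->
  unramified_abelian (biquadratic (p1 * p2 * q))
    (Qadjoin [:: sqrtC p2%:R; sqrtC p1%:R; sqrtC (p1 * p2 * q)%:R; 'i]).
Proof.
move=> p1_pr p2_pr q_pr p12 p1q p2q p1_4 p2_4 q_4.
have pos := (prime_gt0 p1_pr, prime_gt0 p2_pr, prime_gt0 q_pr).
set d := (p1 * p2 * q)%N; set k := biquadratic d; set K := Qadjoin _.
have fk : is_subfield k := Qadjoin_subfield _.
have fK : is_subfield K := Qadjoin_subfield _.
have [[p1_gt0 p2_gt0] q_gt0] := pos.
have d_gt0 : (0 < d)%N by rewrite !muln_gt0 !pos.
have sq (c : algC) : c \in [:: sqrtC p2%:R; sqrtC p1%:R; sqrtC d%:R; 'i] ->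
    exists2 n : int, n != 0 & c ^+ 2 = n%:~R.
  have nz n : (0 < n)%N -> n%:Z != 0 by lia.
  rewrite !inE => /or4P[]/eqP->; [exists p2%:Z | exists p1%:Z | exists d%:Z | exists (-1)];
    by [| exact: nz | exact: sqrtC_natK | exact: sqr_i].
have kK : k `<=` K by move=> x kx; do 2!apply: Qadjoin_cons_sub.
split=> //.
- by apply: abelian_over_Q_multiquadratic => c /sq[n _ ->]; rewrite rpred_int.
- move=> P primeP P0 [J idJ ram].
  have n1 := sqrt_prime_indep p1_pr p2_pr q_pr p12 p1q p2q.
  have n2 : ~ Qadjoin [:: sqrtC p1%:R; sqrtC d%:R; 'i] (sqrtC p2%:R).
    by rewrite /d (mulnC p1); apply: sqrt_prime_indep => // E; apply: p12.
  have ki : k 'i by apply: Qadjoin_mem; rewrite !inE eqxx orbT.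
  have kd : k (sqrtC d%:R) by apply: Qadjoin_mem; rewrite !inE eqxx.
  have k1 : k 1 by exact: subfield1.
  have kid c : k ('i * sqrtC d%:R / c%:R).
    by apply: (subfield_div fk); [exact: (subfieldM fk) | exact: (subfield_nat fk)].
  have half1 : (1 + 1 * sqrtC p1%:R) / 2 \in Aint.
    rewrite mul1r; apply: (@Aint_half _ (p1 %/ 4)%Z); rewrite sqrtC_natK; congr intr.
    by have := divz_eq p1 4; lia.
  have half2 : (1 + 1 * sqrtC p2%:R) / 2 \in Aint.
    rewrite mul1r; apply: (@Aint_half _ (p2 %/ 4)%Z); rewrite sqrtC_natK; congr intr.
    by have := divz_eq p2 4; lia.
  have idE (c e : nat) : (0 < c)%N -> (c * e)%N = d ->
      ('i * sqrtC d%:R / c%:R * sqrtC c%:R) ^+ 2 = (- (e%:Z))%:~R :> algC.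
    move=> c0 cd; rewrite exprMn expr_div_n exprMn !sqrtC_natK sqr_i -cd.
    have : c%:R != 0 :> algC by rewrite pnatr_eq0 -lt0n.
    rewrite PoszM !rmorphM rmorphN /= => c0'; by field.
  have halfid (c e : nat) : (0 < c)%N -> (c * e)%N = d -> (- e%:Z = 1 %[mod 4])%Z ->
      (1 + 'i * sqrtC d%:R / c%:R * sqrtC c%:R) / 2 \in Aint.
    move=> c0 cd e4; apply: (@Aint_half _ (- e%:Z %/ 4)%Z); rewrite (idE _ _ c0 cd).
    by congr intr; have := divz_eq (- e%:Z) 4; lia.
  have intK c : K c -> (1 + c) / 2 \in Aint -> integers K c.
    move=> Kc hA; split=> //; have -> : c = (1 + c) / 2 * 2 - 1 by field.
    by apply: rpredB; [apply: rpredM => //; exact: (Aint_int 2) | exact: rpred1].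
  have K1 : K (sqrtC p1%:R) by apply: Qadjoin_mem; rewrite !inE eqxx orbT.
  have K2 : K (sqrtC p2%:R) by apply: Qadjoin_mem; rewrite !inE eqxx.
  (* Two generators of the same extension of k: the squares of [d1] and [d1'] are p1 and - p2 q, and
     both are multiples of sqrt p1 by elements of k. Likewise [d2] and [d2'] have squares p2 and -
     p1 q. *)
  pose d1 : algC := 1 * sqrtC p1%:R; pose d1' : algC := 'i * sqrtC d%:R / p1%:R * sqrtC p1%:R.
  pose d2 : algC := 1 * sqrtC p2%:R; pose d2' : algC := 'i * sqrtC d%:R / p2%:R * sqrtC p2%:R.
  have dE1 : (p1 * (p2 * q))%N = d by rewrite mulnA.
  have dE2 : (p2 * (p1 * q))%N = d by rewrite mulnCA mulnA.
  have mod4 (a : nat) : (a%:Z = 1 %[mod 4])%Z -> (- (a * q)%N%:Z = 1 %[mod 4])%Z.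
    move=> a4; have := divz_eq a 4; have := divz_eq (- q%:Z) 4; rewrite a4 q_4 PoszM.
    move: (a %/ 4)%Z (- q%:Z %/ 4)%Z => u v qE ->.
    have -> : - ((u * 4 + (1 %% 4)%Z) * q%:Z) = (u * 4 * v + u + v) * 4 + 1.
      by rewrite -mulrN qE (_ : (1 %% 4)%Z = 1) //; ring.
    by rewrite modzMDl.
  have half1' : (1 + d1') / 2 \in Aint.
    by apply: halfid dE1 _; [rewrite pos | exact: mod4].
  have half2' : (1 + d2') / 2 \in Aint.
    by apply: halfid dE2 _; [rewrite pos | exact: mod4].
  have P11 : P (d1 * d2) by exact: (ramified_different sq n1 n2 primeP P0 idJ ram k1 k1 erefl erefl half1 half2).
  have P12 : P (d1 * d2') by exact: (ramified_different sq n1 n2 primeP P0 idJ ram k1 (kid p2) erefl erefl half1 half2').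
  have P21 : P (d1' * d2) by exact: (ramified_different sq n1 n2 primeP P0 idJ ram (kid p1) k1 erefl erefl half1' half2).
  have P22 : P (d1' * d2') by exact: (ramified_different sq n1 n2 primeP P0 idJ ram (kid p1) (kid p2) erefl erefl half1' half2').
  have [_ _ Pprime] := primeP.
  have Od1 : integers K d1 by apply: intK half1; rewrite /d1 mul1r.
  have Od2 : integers K d2 by apply: intK half2; rewrite /d2 mul1r.
  have Od1' : integers K d1' by apply: intK half1'; apply: (subfieldM fK) => //; exact: kK.
  have Od2' : integers K d2' by apply: intK half2'; apply: (subfieldM fK) => //; exact: kK.
  have Psq c (n : int) : c ^+ 2 = n%:~R -> integers K c -> P c -> P n%:~R.
    by move=> <- Oc Pc; rewrite expr2; exact: (prime_ideal_mulr primeP).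
  have copr (a b c : nat) : prime a -> prime b -> prime c -> a <> b -> a <> c ->
      coprimez a (- (b * c)%N%:Z).
    move=> a_pr b_pr c_pr ab ac; rewrite /coprimez /gcdz abszN eqz_nat.
    rewrite -[(_ == _)]/(coprime a (b * c)) coprimeMr !prime_coprime // !dvdn_prime2 //.
    by apply/andP; split; apply/eqP.
  (* The squares of [d2] and [d2'] are coprime integers, so [P] misses one of the two. The four
     products then force both [d1] and [d1'] into [P], although their squares are coprime as
     well. *)
  have no2 : ~ (P d2 /\ P d2').
    move=> [Pd Pd']; apply: (prime_ideal_coprime fK primeP (copr p2 p1 q p2_pr p1_pr q_pr (nesym p12) p2q)).
      by apply: Psq Od2 Pd; rewrite /d2 mul1r sqrtC_natK.
    by apply: Psq Od2' Pd'; apply: idE => //; rewrite pos.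
  have Pd1 : P d1.
    case: (Pprime _ _ Od1 Od2 P11) => // Pd2; case: (Pprime _ _ Od1 Od2' P12) => // Pd2'.
    by case: no2.
  have Pd1' : P d1'.
    case: (Pprime _ _ Od1' Od2 P21) => // Pd2; case: (Pprime _ _ Od1' Od2' P22) => // Pd2'.
    by case: no2.
  apply: (prime_ideal_coprime fK primeP (copr p1 p2 q p1_pr p2_pr q_pr p12 p1q)).
    by apply: Psq Od1 Pd1; rewrite /d1 mul1r sqrtC_natK.
  by apply: Psq Od1' Pd1'; apply: idE => //; rewrite pos.
(* As k contains i, none of its embeddings is real. *)
move=> sigma sR; exfalso.
have ki : k 'i by apply: Qadjoin_mem; rewrite !inE eqxx orbT.
have := sR _ ki; rewrite realEsqr -rmorphXn /= sqrCi rmorphN1 oppr_ge0.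
by rewrite lt_geF ?ltr01.
Qed.

(** * The Pell equation *)

Lemma pigeonhole (T : finType) (f : nat -> T) : exists i j, (i < j)%N /\ f i = f j.
Proof.
apply: contrapT => no; have : injective (fun i : 'I_#|T|.+1 => f i).
  move=> i j fE; apply: val_inj; have [lt|lt|//] := ltngtP (val i) (val j); case: no.
    by exists i; exists j; split; [exact: lt | exact: fE].
  by exists j; exists i; split; [exact: lt | exact: esym].
by move/leq_card; rewrite card_ord ltnn.
Qed.

Section Pell.

Variables (R : archiRcfType) (p : nat).
Let s : R := Num.sqrt p%:R.

(** Among the N + 1 fractional parts of y s, for 0 <= y <= N, two fall in the same of N intervals of
    length 1 / N. *)
Lemma dirichlet_approximation (N : nat) : (0 < N)%N ->
  exists X Y : int, [/\ Y != 0, `|Y| <= N%:Z & N%:R * `|X%:~R - Y%:~R * s| < 1].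
Proof.
move=> N_gt0; have N0 : 0 < N%:R :> R by rewrite ltr0n.
pose fl (y : 'I_N.+1) := Num.floor (y%:R * s).
pose fr (y : 'I_N.+1) := y%:R * s - (fl y)%:~R.
have fr_itv y : 0 <= fr y < 1.
  have := floor_itv (y%:R * s); rewrite -/(fl y) intrD /fr.
  by move: (_ * s) (_%:~R) => u v; lra.
pose tr (y : 'I_N.+1) := Num.truncn (N%:R * fr y).
have tr_itv y : (tr y)%:R <= N%:R * fr y < (tr y).+1%:R.
  by apply: truncn_itv; rewrite mulr_ge0 ?ler0n //; case/andP: (fr_itv y).
have tr_lt y : (tr y < N)%N.
  rewrite truncn_lt_nat; last by rewrite mulr_ge0 ?ler0n //; case/andP: (fr_itv y).
  by rewrite -[ltRHS]mulr1 ltr_pM2l //; case/andP: (fr_itv y).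
have [y1 [y2 [y12 trE]]] : exists y1 y2, y1 != y2 /\ tr y1 = tr y2.
  apply: contrapT => no; have : injective (fun y => Ordinal (tr_lt y)).
    move=> y1 y2 [E]; apply/eqP; apply/negPn/negP => y12.
    by apply: no; exists y1, y2.
  by move/leq_card; rewrite !card_ord ltnn.
exists (fl y1 - fl y2), (y1%:Z - y2%:Z); split.
- by rewrite subr_eq0 eqz_nat.
- by have := ltn_ord y1; have := ltn_ord y2; lia.
have -> : (fl y1 - fl y2)%:~R - (y1%:Z - y2%:Z)%:~R * s = fr y2 - fr y1.
  by rewrite /fr !intrB /=; ring.
rewrite -[X in X * _](gtr0_norm N0) -normrM mulrBr.
have /andP[l1 u1] := tr_itv y1; have /andP[l2 u2] := tr_itv y2.
rewrite trE in l1 u1; rewrite ltr_norml.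
move: l1 u1 l2 u2; rewrite -natr1; move: (N%:R * _) (N%:R * _) (_%:R) => u v w; lra.
Qed.

Hypothesis p_nonsquare : forall X Y : int, Y != 0 -> X ^+ 2 - p%:Z * Y ^+ 2 != 0.

Let delta (x : int * int) : R := `|x.1%:~R - x.2%:~R * s|.
Let norm (x : int * int) : int := x.1 ^+ 2 - p%:Z * x.2 ^+ 2.

Let s_ge0 : 0 <= s. Proof. exact: sqrtr_ge0. Qed.

Let s2 : s * s = p%:R. Proof. by rewrite -expr2 sqr_sqrtr ?ler0n. Qed.

Lemma normE x : (norm x)%:~R = (x.1%:~R - x.2%:~R * s) * (x.1%:~R + x.2%:~R * s).
Proof.
rewrite /norm !expr2 intrB !intrM -[(p%:Z)%:~R]/(p%:R) -s2; ring.
Qed.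

(** The bound does not depend on the quality of the approximation: if |Y| <= N and N delta < 1, then
    |X + Y s| <= delta + 2 N s, and the product with delta stays below 1 + 2 s. *)
Let good (x : int * int) : Prop := x.2 != 0 /\ `|(norm x)%:~R| < 1 + 2 * s.

Lemma good_pair (N : nat) : (0 < N)%N -> exists2 x, good x & N%:R * delta x < 1.
Proof.
move=> N_gt0; have [X [Y [Y0 YN dN]]] := dirichlet_approximation N_gt0.
exists (X, Y) => //; split=> //=; rewrite normE normrM /=.
have {}YN : `|Y%:~R| <= N%:R :> R by rewrite -intr_norm -[N%:R]/(N%:Z%:~R) ler_int.
have N1 : 1 <= N%:R :> R by rewrite ler1n.
set d := `|X%:~R - _| in dN *; have d0 : 0 <= d by exact: normr_ge0.
have d1 : d < 1 by nra.
have le : `|X%:~R + Y%:~R * s| <= d + 2 * (N%:R * s).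
  have -> : X%:~R + Y%:~R * s = (X%:~R - Y%:~R * s) + 2 * (Y%:~R * s) by ring.
  apply: (le_trans (ler_normD _ _)); rewrite lerD2l !normrM (ger0_norm s_ge0) normr_nat.
  by rewrite ler_pM2l ?ltr0n // ler_wpM2r.
apply: (le_lt_trans (ler_wpM2l d0 le)).
have -> : d * (d + 2 * (N%:R * s)) = d * d + (N%:R * d) * (2 * s) by ring.
have h1 : d * d < 1 by nra.
have h2 : N%:R * d * (2 * s) <= 1 * (2 * s) by apply: ler_wpM2r; [rewrite mulr_ge0 | exact: ltW].
lra.
Qed.

Lemma delta_gt0 x : x.2 != 0 -> 0 < delta x.
Proof.
move=> x2; rewrite normr_gt0; apply: contra_neq (p_nonsquare x.1 x2) => E.
by apply: (@intr_inj R); rewrite normE E mul0r.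
Qed.

(** Good pairs with strictly decreasing [delta] form an infinite sequence of bounded norm. Two of
    them share the norm m and both coordinates modulo m, and their quotient is an integral
    solution. *)
Lemma pell_nontrivial : exists u v : int, v != 0 /\ u ^+ 2 - p%:Z * v ^+ 2 = 1.
Proof.
have /choice[nxt nxtP] : forall x, exists y, good x -> good y /\ delta y < delta x.
  move=> x; have [gx|] := pselect (good x); last by exists x.
  have d0 := delta_gt0 gx.1; pose N := Num.bound (delta x)^-1.
  have Nd : 1 < N%:R * delta x.
    by rewrite -ltr_pdivrMr // div1r; apply: archi_boundP; rewrite invr_ge0 ltW.
  have N_gt0 : (0 < N)%N by case: N Nd => //; rewrite mul0r ltr10.
  have [y gy dy] := good_pair N_gt0; exists y => _; split=> //.
  by rewrite -(ltr_pM2l (_ : 0 < N%:R)) ?ltr0n //; exact: lt_trans dy Nd.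
have [x0 gx0 _] := good_pair (ltn0Sn 0); pose xs i := iter i nxt x0.
have gxs i : good (xs i) by elim: i => [|i IH] //=; case: (nxtP _ IH).
have decr i j : (i < j)%N -> delta (xs j) < delta (xs i).
  elim: j => // j IH; rewrite ltnS leq_eqVlt => /predU1P[->|ij].
    by case: (nxtP _ (gxs j)).
  by apply: lt_trans (IH ij); case: (nxtP _ (gxs j)).
pose M := Num.bound (1 + 2 * s).
have normM i : `|norm (xs i)| < M%:Z.
  have [_ lt1] := gxs i; rewrite -(ltr_int R) intr_norm; apply: lt_trans lt1 _.
  by apply: archi_boundP; rewrite addr_ge0 // mulr_ge0.
have norm0 i : norm (xs i) != 0 by apply: p_nonsquare; case: (gxs i).
(* The norm is shifted by [M] to become a natural number; the other components are the coordinates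
   modulo the norm. *)
pose cl i : 'I_(M + M).+1 * 'I_M.+1 * 'I_M.+1 :=
  (inord (absz (norm (xs i) + M%:Z)), inord (absz ((xs i).1 %% norm (xs i))%Z),
   inord (absz ((xs i).2 %% norm (xs i))%Z)).
have [i [j [ij clE]]] := pigeonhole cl.
move: clE => -[] /(congr1 val) /=; rewrite !inordK; last 2 first.
- by have := normM j; move: (norm _); lia.
- by have := normM i; move: (norm _); lia.
move=> nE; have {nE} mE : norm (xs i) = norm (xs j) by have := normM i; have := normM j; lia.
have modM a : (`|(a %% norm (xs j))%Z| < M.+1)%N.
  by have := ltz_mod a (norm0 j); have := modz_ge0 a (norm0 j); have := normM j; lia.
rewrite mE => /(congr1 val); rewrite /= !inordK // => c1 /(congr1 val); rewrite /= !inordK // => c2.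
have {}c1 : ((xs i).1 = (xs j).1 %[mod norm (xs j)])%Z.
  have := modz_ge0 (xs i).1 (norm0 j); have := modz_ge0 (xs j).1 (norm0 j).
  by move: c1; move: (_ %% _)%Z (_ %% _)%Z; lia.
have {}c2 : ((xs i).2 = (xs j).2 %[mod norm (xs j)])%Z.
  have := modz_ge0 (xs i).2 (norm0 j); have := modz_ge0 (xs j).2 (norm0 j).
  by move: c2; move: (_ %% _)%Z (_ %% _)%Z; lia.
have := decr i j ij; move: mE c1 c2 (norm0 j); rewrite /delta /norm.
case: (xs i) (xs j) => [X1 Y1] [X2 Y2] /=; set m := X2 ^+ 2 - _ => mE.
move=> /eqP; rewrite eqz_mod_dvd => /dvdzP[a aE] /eqP; rewrite eqz_mod_dvd => /dvdzP[b bE] m0 dlt.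
have {aE} X1E : X1 = X2 + a * m by rewrite -aE; ring.
have {bE} Y1E : Y1 = Y2 + b * m by rewrite -bE; ring.
(* u + v sqrt p is (X1 + Y1 sqrt p) / (X2 + Y2 sqrt p): the coordinates X1 X2 - p Y1 Y2 and Y1 X2 -
   X1 Y2 are divided by m after substituting X1 = X2 + a m and Y1 = Y2 + b m. *)
pose u := 1 + a * X2 - p%:Z * b * Y2; pose v := b * X2 - a * Y2.
have um : u * m = X1 * X2 - p%:Z * Y1 * Y2 by rewrite X1E Y1E /u /m; ring.
have vm : v * m = Y1 * X2 - X1 * Y2 by rewrite X1E Y1E /v; ring.
have uv1 : u ^+ 2 - p%:Z * v ^+ 2 = 1.
  apply: (mulIf (expf_neq0 2 m0)); rewrite mul1r.
  have -> : (u ^+ 2 - p%:Z * v ^+ 2) * m ^+ 2 = (u * m) ^+ 2 - p%:Z * (v * m) ^+ 2 by ring.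
  rewrite um vm [m ^+ 2](_ : _ = (X1 ^+ 2 - p%:Z * Y1 ^+ 2) * m); last by rewrite mE expr2.
  by rewrite /m; ring.
(* If v = 0, the two pairs differ at most by a sign and have the same [delta], against strict
   decrease. *)
exists u, v; split=> //; apply/eqP => v0.
have u1 : u = 1 \/ u = -1.
  by move: uv1; rewrite v0 expr0n mulr0 subr0 => /eqP; rewrite sqrf_eq1 => /orP[]/eqP; [left|right].
have XE : X1 = u * X2.
  apply: (mulIf m0); have -> : u * X2 * m = u * m * X2 by ring.
  rewrite um; have -> : X1 * m = (X1 * X2 - p%:Z * Y1 * Y2) * X2 + p%:Z * Y2 * (v * m).
    by rewrite vm /m; ring.
  by rewrite v0 mul0r mulr0 addr0.
have YE : Y1 = u * Y2.
  apply: (mulIf m0); have -> : u * Y2 * m = u * m * Y2 by ring.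
  rewrite um; have -> : Y1 * m = (X1 * X2 - p%:Z * Y1 * Y2) * Y2 + X2 * (v * m).
    by rewrite vm /m; ring.
  by rewrite v0 mul0r mulr0 addr0.
move: dlt; rewrite XE YE !rmorphM /= -mulrA -mulrBr normrM.
by case: u1 => ->; rewrite ?rmorphN ?normrN normr1 mul1r ltxx.
Qed.

End Pell.

(** * Squares of coprime factors and units of norm -1 *)

(** The root is g = gcd(a, c). With a = a' g and c = c' g one gets a' b = c'^2 g, where a' is prime
    to c' and g is prime to b; so a' and g divide each other. *)
Lemma coprime_mul_square (a b c : nat) : coprime a b -> (a * b = c ^ 2)%N ->
  exists m, a = (m ^ 2)%N.
Proof.
move=> ab abc; exists (gcdn a c); have [g0|g_gt0] := posnP (gcdn a c).
  by have := dvdn_gcdl a c; rewrite g0 dvd0n => /eqP.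
have [a' aE] := dvdnP (dvdn_gcdl a c); have [c' cE] := dvdnP (dvdn_gcdr a c).
move: g_gt0 aE cE (erefl (gcdn a c)); set g := {1 2 3 5}(gcdn a c) => g_gt0 aE cE gE.
have ac' : coprime a' c'.
  by rewrite /coprime -(eqn_pmul2r g_gt0) muln_gcdl -aE -cE gE mul1n.
have E : (a' * b = c' ^ 2 * g)%N.
  apply/eqP; rewrite -(eqn_pmul2r g_gt0); apply/eqP.
  by move: abc; rewrite aE cE expnMn; nia.
have d1 : (a' %| g)%N.
  by rewrite -(@Gauss_dvdr _ (c' ^ 2)) ?coprimeXr // -E dvdn_mulr.
have d2 : (g %| a')%N.
  rewrite -(@Gauss_dvdl _ _ b); first by rewrite E dvdn_mull.
  by apply: coprime_dvdl ab; rewrite aE dvdn_mull.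
have -> : gcdn a c = g by [].
by rewrite aE (_ : a' = g) ?mulnn //; apply/eqP; rewrite eqn_dvd d1 d2.
Qed.

Lemma prime_nonsquare (p : nat) : prime p ->
  forall X Y : int, Y != 0 -> X ^+ 2 - p%:Z * Y ^+ 2 != 0.
Proof.
move=> p_pr X Y Y0; apply/eqP => E.
have XE : (`|X| ^ 2 = p * `|Y| ^ 2)%N by apply/eqP; nia.
have Y2_gt0 : (0 < `|Y| ^ 2)%N by rewrite expn_gt0 absz_gt0 Y0.
have := congr1 (odd \o logn p) XE; rewrite /= (lognM _ (prime_gt0 p_pr) Y2_gt0).
by rewrite !lognX !mul2n oddD !odd_double logn_prime // eqxx.
Qed.

(* Descent on the solutions of [u^2 - p v^2 = 1]. *)
Lemma negative_pell (p : nat) : prime p -> (p %% 4 = 1)%N ->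
  exists a b : nat, (a ^ 2 + 1 = p * b ^ 2)%N.
Proof.
move=> p_pr p4.
suff desc n : forall v u : nat, (v < n)%N -> (0 < v)%N -> (u ^ 2 = p * v ^ 2 + 1)%N ->
    exists a b : nat, (a ^ 2 + 1 = p * b ^ 2)%N.
  have [u [v [v0 uv]]] := @pell_nontrivial realalg p (prime_nonsquare p_pr).
  by apply: (desc `|v|.+1 `|v|%N `|u|%N) => //; [rewrite absz_gt0 | nia].
elim: n => // n IH v u vn v_gt0 uv.
(* An odd v would make u^2 = p v^2 + 1 congruent to 2 modulo 4. *)
have [w vE] : exists w, v = w.*2.
  exists v./2; apply/esym/even_halfK; apply/negP => odd_v.
  have := divn_eq p 4; rewrite p4 => pE; have := odd_double_half v; rewrite odd_v => vE.
  have := odd_double_half u; move: uv; rewrite -vE pE.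
  by case: (odd u) => + /= uE; rewrite -uE; nia.
have [t uE] : exists t, u = t.*2.+1.
  exists u./2; have := odd_double_half u; have := odd_double_half u.
  by case: (odd u) => //= {2}<-; move: uv; rewrite vE; nia.
have tE : (t * t.+1 = p * w ^ 2)%N by move: uv; rewrite vE uE; nia.
have ct : coprime t t.+1 by exact: coprimenS.
have : (p %| t * t.+1)%N by rewrite tE dvdn_mulr.
(* t and t + 1 are coprime with product p w^2. If p divides t, then t = p b^2 and t + 1 = a^2 give a
   smaller solution; if p divides t + 1, then t = a^2 and t + 1 = p b^2 give norm -1. *)
rewrite Euclid_dvdM // => /orP[] /dvdnP[t' t'E].
  have cE : (t' * t.+1 = w ^ 2)%N.
    by apply/eqP; rewrite -(eqn_pmul2l (prime_gt0 p_pr)) -tE t'E; apply/eqP; nia.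
  have ct' : coprime t' t.+1 by apply: coprime_dvdl ct; rewrite t'E dvdn_mulr.
  have [b bE] := coprime_mul_square ct' cE.
  have [a aE] : exists m, t.+1 = (m ^ 2)%N.
    by apply: (@coprime_mul_square _ t' w); rewrite 1?coprime_sym // mulnC.
  have w_gt0 : (0 < w)%N by move: v_gt0; rewrite vE double_gt0.
  have b_gt0 : (0 < b)%N.
    by rewrite lt0n; apply: contraTneq w_gt0 => b0; move: cE; rewrite bE b0 mul0n; case: (w).
  have bw : (b <= w)%N by rewrite -leq_sqr -bE -cE leq_pmulr.
  apply: (IH b a) => //; last by rewrite -aE -bE t'E mulnC addn1.
  by move: vn; rewrite vE -addnn; lia.
have cE : (t * t' = w ^ 2)%N.
  by apply/eqP; rewrite -(eqn_pmul2l (prime_gt0 p_pr)) -tE t'E; apply/eqP; nia.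
have ct' : coprime t t' by apply: coprime_dvdr ct; rewrite t'E dvdn_mulr.
have [a aE] := coprime_mul_square ct' cE.
have [b bE] : exists m, t' = (m ^ 2)%N.
  by apply: (@coprime_mul_square _ t w); rewrite 1?coprime_sym // mulnC.
by exists a, b; rewrite -aE addn1 t'E bE mulnC.
Qed.

(** * Units and principal ideals *)

Lemma int_parity (n : int) : exists m, n = m * 2 \/ n = m * 2 + 1.
Proof.
exists (n %/ 2)%Z; have := divz_eq n 2; have := modz_ge0 n (isT : 2 != 0 :> int).
by have := ltz_pmod n (isT : 0 < 2 :> int); lia.
Qed.

Lemma Posz_sqr (n : nat) : (n ^ 2)%N%:Z = n%:Z ^+ 2.
Proof. by rewrite -mulnn PoszM expr2. Qed.

Lemma Euclid_dvdzM (p : nat) (m n : int) : prime p ->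
  (p%:Z %| m * n)%Z = (p%:Z %| m)%Z || (p%:Z %| n)%Z.
Proof. by move=> p_pr; rewrite !dvdzE abszM Euclid_dvdM. Qed.

(* If [u^2 + 1 = p v^2], then up to the sign of [u] the Gaussian integer [u + i] is
   [(e + 2 f i) (r + s i)] with coprime [r], [s] and [r^2 + s^2 = v^2], and
   [a], [b] parametrise this Pythagorean triple. *)
Lemma gauss_form_unit (p : nat) (e f : int) : prime p -> (p %% 4 = 1)%N ->
  p%:Z = e ^+ 2 + 4 * f ^+ 2 ->
  exists a b : int, e * (a ^+ 2 - b ^+ 2) + 4 * f * a * b = 1.
Proof.
move=> p_pr p4 pE; have [U [V UV]] := negative_pell p_pr p4.
have {}UV : U%:Z ^+ 2 + 1 = p%:Z * V%:Z ^+ 2.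
  by have := congr1 Posz UV; rewrite PoszD PoszM !Posz_sqr.
have p0 : p%:Z != 0 by have := prime_gt0 p_pr; lia.
(* The quotient (u + i) / (e + 2 f i) is r + s i with r p = u e + 2 f and s p = e - 2 f u. The prime
   p divides e^2 - 4 f^2 U^2, hence one of its two factors, which fixes the sign of u. *)
have [u [s [uV sE]]] : exists u s : int, u ^+ 2 + 1 = p%:Z * V%:Z ^+ 2 /\ e - 2 * f * u = s * p%:Z.
  have : (p%:Z %| (e - 2 * f * U%:Z) * (e - 2 * f * - U%:Z))%Z.
    apply/dvdzP; exists (1 - 4 * f ^+ 2 * V%:Z ^+ 2).
    transitivity (e ^+ 2 + 4 * f ^+ 2 - 4 * f ^+ 2 * (U%:Z ^+ 2 + 1)); first by ring.
    by rewrite UV -pE; ring.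
  rewrite Euclid_dvdzM // => /orP[]/dvdzP[s sE]; first by exists U%:Z, s.
  by exists (- U%:Z), s; rewrite sqrrN.
have [r rE] : exists r, u * e + 2 * f = r * p%:Z.
  apply/dvdzP; suff : (p%:Z %| (u * e + 2 * f) * (u * e + 2 * f))%Z by rewrite Euclid_dvdzM // orbb.
  apply/dvdzP; exists (p%:Z * V%:Z ^+ 2 - s ^+ 2 * p%:Z).
  transitivity ((u ^+ 2 + 1) * (e ^+ 2 + 4 * f ^+ 2) - (e - 2 * f * u) ^+ 2); first by ring.
  by rewrite uV sE -pE; ring.
have rs : r ^+ 2 + s ^+ 2 = V%:Z ^+ 2.
  apply: (mulIf (expf_neq0 2 p0)).
  transitivity ((r * p%:Z) ^+ 2 + (s * p%:Z) ^+ 2); first by ring.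
  rewrite -rE -sE; transitivity ((u ^+ 2 + 1) * (e ^+ 2 + 4 * f ^+ 2)); first by ring.
  by rewrite uV -pE; ring.
have rs1 : e * s + 2 * f * r = 1.
  apply: (mulIf p0); transitivity (e * (s * p%:Z) + 2 * f * (r * p%:Z)); first by ring.
  by rewrite -rE -sE mul1r [RHS]pE; ring.
(* Parities of the triple: s is odd by e s + 2 f r = 1, V is odd because 4 does not divide u^2 + 1,
   and then r^2 = V^2 - s^2 is even. *)
have [s' sE'] := int_parity s; have [R RE] := int_parity r.
have [V' VE'] := int_parity V%:Z; have [u' uE'] := int_parity u.
have {}sE' : s = s' * 2 + 1.
  case: sE' => // sE'; exfalso; move: rs1; rewrite sE'.
  have -> : e * (s' * 2) + 2 * f * r = (e * s' + f * r) * 2 by ring.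
  by move: (_ + _); lia.
have {}VE' : V%:Z = V' * 2 + 1.
  case: VE' => // VE'; exfalso; move: uV; rewrite VE'.
  have -> : p%:Z * (V' * 2) ^+ 2 = 4 * (p%:Z * V' ^+ 2) by ring.
  case: uE' => ->; last have -> : (u' * 2 + 1) ^+ 2 + 1 = 4 * (u' ^+ 2 + u') + 2 by ring.
    have -> : (u' * 2) ^+ 2 + 1 = 4 * u' ^+ 2 + 1 by ring.
    by move: (_ ^+ 2) (_ * _ ^+ 2); lia.
  by move: (_ + u') (_ * _ ^+ 2); lia.
have {}RE : r = R * 2.
  case: RE => // RE; exfalso; move: rs; rewrite RE sE' VE'.
  have -> : (R * 2 + 1) ^+ 2 + (s' * 2 + 1) ^+ 2 = 4 * (R ^+ 2 + R + s' ^+ 2 + s') + 2 by ring.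
  have -> : (V' * 2 + 1) ^+ 2 = 4 * (V' ^+ 2 + V') + 1 by ring.
  by move: (_ + s') (_ + V'); lia.
have sV : `|s| <= V%:Z.
  rewrite -ler_sqr ?nnegrE // -normrX ger0_norm ?sqr_ge0 // -rs lerDr sqr_ge0 //.
have [A [B [AE BE]]] : exists A B : nat, V%:Z + s = 2 * A%:Z /\ V%:Z - s = 2 * B%:Z.
  exists (absz (V' + s' + 1)), (absz (V' - s')); clear -sE' VE' sV; lia.
have ABR : (A * B = `|R| ^ 2)%N.
  apply/eqP; rewrite -eqz_nat PoszM Posz_sqr abszE real_normK ?num_real //; apply/eqP.
  apply: (@mulfI _ 4) => //; transitivity ((2 * A%:Z) * (2 * B%:Z)); first by ring.
  rewrite -AE -BE; transitivity (V%:Z ^+ 2 - s ^+ 2); first by ring.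
  by rewrite -rs RE; ring.
have sAB : s = A%:Z - B%:Z by clear -AE BE; lia.
(* If g divides A and B, then g^2 divides R^2, so g divides both r and s, hence e s + 2 f r = 1. *)
have coAB : coprime A B.
  rewrite /coprime -dvdn1; set g := gcdn A B.
  have gR : (g %| `|R|)%N.
    by rewrite -(dvdn_pexp2r _ _ (isT : 0 < 2)%N) -ABR expnS expn1 dvdn_mul ?dvdn_gcdl ?dvdn_gcdr.
  suff : (g%:Z %| e * s + 2 * f * r)%Z by rewrite rs1 dvdzE.
  rewrite sAB RE; apply: rpredD; apply: dvdz_mull; last by apply: dvdz_mulr; rewrite dvdzE.
  by apply: rpredB; rewrite dvdzE ?dvdn_gcdl ?dvdn_gcdr.
have [a aE] := coprime_mul_square coAB ABR.
have [b bE] : exists m, B = (m ^ 2)%N.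
  by apply: (@coprime_mul_square _ A `|R|%N); rewrite 1?coprime_sym // mulnC.
have abR : (a * b)%N = `|R|%N.
  by apply/eqP; rewrite -(@eqn_exp2r _ _ 2) // expnMn -aE -bE ABR.
(* The sign of R is carried by b, which otherwise enters only through its square. *)
have fin (b' : int) : b' ^+ 2 = b%:Z ^+ 2 -> R = a%:Z * b' ->
    e * (a%:Z ^+ 2 - b' ^+ 2) + 4 * f * a%:Z * b' = 1.
  move=> b2 RE'; transitivity (e * s + 2 * f * r) => //.
  by rewrite sAB RE RE' aE bE !Posz_sqr b2; ring.
case: (lerP 0 R) => R0.
  by exists a%:Z, b%:Z; apply: fin => //; rewrite -PoszM abR; clear -R0; lia.
by exists a%:Z, (- b%:Z); apply: fin; rewrite ?sqrrN // mulrN -PoszM abR; clear -R0; lia.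
Qed.

Lemma gauss_prime_unit_square K (p : nat) (e f : int) :
  is_subfield K -> K (sqrtC p%:R) -> K 'i -> prime p -> (p %% 4 = 1)%N ->
  p%:Z = e ^+ 2 + 4 * f ^+ 2 ->
  exists beta eps : algC, [/\ K beta, integers K eps, integers K eps^-1, eps != 0
    & beta ^+ 2 = eps * (e%:~R + 2 * 'i * f%:~R)].
Proof.
move=> fK Kp Ki p_pr p4 pE; have [a [b ab1]] := gauss_form_unit p_pr p4 pE.
have KI (n : int) : K n%:~R := subfield_int fK n.
have KM := @subfieldM K fK; have KD := @subfieldD K fK; have KN := @subfieldN K fK.
(* u is the real part of i (e + 2 f i) (a - b i)^2, whose imaginary part is 1 by [ab1]; v is the
   norm of a - b i. *)
pose u : int := 2 * e * a * b - 2 * f * (a ^+ 2 - b ^+ 2); pose v : int := a ^+ 2 + b ^+ 2.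
have uv : u ^+ 2 + 1 = p%:Z * v ^+ 2.
  by rewrite -[X in _ + X](expr1n _ 2) -[X in _ + X ^+ 2]ab1 pE /u /v; ring.
set w := sqrtC p%:R in Kp; have w2 : w ^+ 2 = p%:R by rewrite sqrtCK.
pose eps : algC := u%:~R + v%:~R * w; pose eps' : algC := - (u%:~R - v%:~R * w).
have wA : w \in Aint by apply: Aint_sqrt; rewrite w2; exact: (Aint_int p%:Z).
have ee : eps * eps' = 1.
  have -> : eps * eps' = v%:~R ^+ 2 * w ^+ 2 - u%:~R ^+ 2 by rewrite /eps /eps'; ring.
  have uvC : u%:~R * u%:~R + 1 = (p%:Z)%:~R * (v%:~R * v%:~R) :> algC.
    by rewrite -!intrM -[1]/(1%:~R) -intrD -!expr2 uv.
  rewrite w2 -[p%:R]/((p%:Z)%:~R); transitivity ((p%:Z)%:~R * (v%:~R * v%:~R) - u%:~R * u%:~R : algC).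
    by ring.
  by rewrite -uvC; ring.
have e0 : eps != 0 by apply: contra_eq_neq ee => ->; rewrite mul0r eq_sym oner_eq0.
have Oeps : integers K eps.
  split; first by apply: (KD) => //; exact: KM.
  by rewrite rpredD ?rpredM ?Aint_int.
have Oeps' : integers K eps'.
  split; first by apply: (KN); apply: (subfieldB fK) => //; exact: KM.
  by rewrite rpredN rpredB ?rpredM ?Aint_int.
have epsV : eps^-1 = eps' by apply: (mulfI e0); rewrite divff // ee.
pose z : algC := a%:~R - b%:~R * 'i.
have i2 : 'i ^+ 2 + 1 = 0 :> algC by rewrite sqrCi addNr.
have uiE : u%:~R + 'i = (e%:~R + 2 * 'i * f%:~R) * 'i * z ^+ 2.
  have ab1C : e%:~R * (a%:~R ^+ 2 - b%:~R ^+ 2) + 4 * f%:~R * a%:~R * b%:~R = 1 :> algC.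
    by rewrite -[RHS]/(1%:~R) -ab1 !(rmorphD, rmorphM, rmorphB) /=; ring.
  (* As polynomials in i the two sides agree only modulo i^2 + 1; [Q] is the cofactor of i^2 + 1 in
     their difference. *)
  pose Q : algC := - 2 * e%:~R * a%:~R * b%:~R + e%:~R * b%:~R ^+ 2 * 'i + 2 * f%:~R * a%:~R ^+ 2
    - 4 * f%:~R * a%:~R * b%:~R * 'i + 2 * f%:~R * b%:~R ^+ 2 * ('i ^+ 2 - 1).
  transitivity (u%:~R + 'i * (e%:~R * (a%:~R ^+ 2 - b%:~R ^+ 2) + 4 * f%:~R * a%:~R * b%:~R)
      + ('i ^+ 2 + 1) * Q); first by rewrite i2 mul0r addr0 ab1C mulr1.
  by rewrite /u !(rmorphD, rmorphM, rmorphB) /= /Q /z; ring.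
(* As (1 + i)^2 = 2 i, dividing (eps + i)^2 = 2 eps (u + i) by t^2 = 2 i z^2 leaves eps (e + 2 f
   i). *)
pose t := (1 + 'i) * z.
have t2 : t ^+ 2 = 2 * 'i * z ^+ 2.
  have -> : t ^+ 2 = 2 * 'i * z ^+ 2 + ('i ^+ 2 + 1) * z ^+ 2 by rewrite /t; ring.
  by rewrite i2 mul0r addr0.
have t0 : t != 0.
  rewrite -sqrf_eq0 t2; apply/eqP => E; have : (u%:~R + 'i) * 2 = 0 :> algC.
    rewrite uiE; transitivity ((e%:~R + 2 * 'i * f%:~R) * (2 * 'i * z ^+ 2)); first by ring.
    by rewrite E mulr0.
  move/eqP; rewrite mulf_eq0 pnatr_eq0 orbF addr_eq0 => /eqP/(congr1 (fun x => x ^+ 2)).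
  rewrite sqrrN sqrCi -rmorphXn => /eqP; rewrite -subr_eq0 opprK -[1]/(1%:~R) -rmorphD /= intr_eq0.
  by have := sqr_ge0 u; lia.
exists ((eps + 'i) / t), eps; split=> //.
- apply: (subfield_div fK); first by apply: (KD) => //; case: Oeps.
  apply: (KM); first by apply: (KD) => //; exact: subfield1.
  by apply: (subfieldB fK) => //; exact: KM.
- by rewrite epsV.
rewrite expr_div_n; apply: (mulIf (expf_neq0 2 t0)); rewrite divfK ?expf_neq0 // t2.
transitivity (2 * eps * ((e%:~R + 2 * 'i * f%:~R) * 'i * z ^+ 2)); last by ring.
rewrite -uiE; transitivity (eps ^+ 2 - eps * eps' + 2 * eps * 'i + ('i ^+ 2 + 1)).
  by rewrite ee; ring.
by rewrite i2 addr0 /eps' /eps; ring.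
Qed.

Lemma principal_unit K a eps : is_subfield K -> integers K eps -> integers K eps^-1 -> eps != 0 ->
  principal_ideal K (eps * a) = principal_ideal K a.
Proof.
move=> fK Oe Oe' e0; apply/seteqP; split=> _ [x Ox <-].
  by exists (eps * x); [exact: integersM | rewrite mulrCA mulrA].
by exists (eps^-1 * x); [exact: integersM | rewrite mulrACA divff // mul1r].
Qed.

Lemma principal_mul K a b : is_subfield K ->
  ideal_mul (principal_ideal K a) (principal_ideal K b) = principal_ideal K (a * b).
Proof.
move=> fK; rewrite ideal_mul_scalel ideal_mul_scaler scale_idealA; congr scale_ideal.
by apply: extend_submodule => //; exact: submodule_integers.
Qed.

Lemma ideal_fractional K I : is_subfield K -> ideal K I -> (exists2 x, I x & x != 0) ->
  fractional_ideal K I.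
Proof.
move=> fK [sI IO] nzI; split=> //; exists 1.
by split; [exact: integers1 | rewrite oner_eq0 | move=> x /IO; rewrite mul1r].
Qed.

Lemma square_capitulates k K H pi beta eps :
  is_subfield k -> is_subfield K -> k `<=` K -> ideal k H -> (exists2 x, H x & x != 0) ->
  ideal_mul H H = principal_ideal k pi -> pi != 0 ->
  K beta -> integers K eps -> integers K eps^-1 -> eps != 0 -> beta ^+ 2 = eps * pi ->
  capitulation_kernel k K (ideal_class k H).
Proof.
move=> fk fK kK idH nzH HH pi0 Kb Oe Oe' e0 b2.
have b0 : beta != 0 by rewrite -sqrf_eq0 b2 mulf_neq0.
split; first by exists H => //; exact: ideal_fractional.
rewrite extend_classE //.
suff -> : extend_ideal K H = principal_ideal K beta by exact: class_principal.
apply: square_principal => //.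
  by apply: submodule_extend => // x Hx; apply: kK; case: idH => -[+ _ _ _] _; exact.
by rewrite -extend_mul // HH extend_principal // b2 principal_unit.
Qed.

(** The sum 2 e of the conjugates [pi] and [pi'] is prime to their product p, and so is r. Hence al
    pi' = 1 - pi X and be' r = 1 - pi Y with Gaussian integers X, Y, and multiplying the two
    relations gives the claim. *)
Lemma gauss_conjugates_coprime (p : nat) (e f r : int) : prime p -> (p %% 4 = 1)%N ->
  p%:Z = e ^+ 2 + 4 * f ^+ 2 -> coprimez p%:Z r ->
  exists u v : algC, [/\ integers gauss_field u, integers gauss_field v
    & u * (e%:~R + 2 * 'i * f%:~R) + v * ((e%:~R - 2 * 'i * f%:~R) * r%:~R) = 1].
Proof.
move=> p_pr p4 pE /eqP pr.
have fG : is_subfield gauss_field := Qadjoin_subfield _.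
have p_gt1 := prime_gt1 p_pr.
have p2e : gcdz (2 * e) p%:Z = 1.
  apply/eqP; rewrite /gcdz eqz_nat gcdnC -[(_ == _)]/(coprime p _) prime_coprime //.
  rewrite abszM Euclid_dvdM // negb_or; apply/andP; split.
    apply/negP => /dvdn_leq => /(_ isT) p_le; move: p4.
    by rewrite (_ : p = 2%N) //; apply/eqP; rewrite eqn_leq p_le.
  (* If p divides e, then either e = 0 and p = 4 f^2, or p <= |e| against e^2 <= p. *)
  apply/negP => pe; have [e0|e_gt0] := posnP `|e|%N.
    move: pE; rewrite (_ : e = 0) ?expr0n ?add0r; last by apply/eqP; rewrite -absz_eq0 e0.
    move=> pE; move: p4; have -> : p = (4 * `|f| ^ 2)%N.
      by apply/eqP; rewrite -eqz_nat pE PoszM Posz_sqr abszE real_normK ?num_real.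
    by rewrite mulnC modnMl.
  have := dvdn_leq e_gt0 pe => p_le; have : (`|e| ^ 2 <= p)%N.
    by rewrite -lez_nat pE Posz_sqr abszE real_normK ?num_real // lerDl mulr_ge0 ?sqr_ge0.
  by rewrite -mulnn; nia.
have [al [be abE]] := Bezoutz (2 * e) p%:Z; have [al' [be' abE']] := Bezoutz p%:Z r.
rewrite p2e in abE; rewrite pr in abE'.
set pi := e%:~R + _; set pi' := e%:~R - _.
have i2 : 'i ^+ 2 + 1 = 0 :> algC by rewrite sqrCi addNr.
have ppE : pi * pi' = (p%:Z)%:~R.
  rewrite pE !(rmorphD, rmorphM) /=.
  transitivity (e%:~R ^+ 2 + 4 * f%:~R ^+ 2 - 4 * f%:~R ^+ 2 * ('i ^+ 2 + 1) : algC).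
    by rewrite /pi /pi'; ring.
  by rewrite i2 mulr0 subr0; ring.
have E1 : al%:~R * (pi + pi') + be%:~R * (pi * pi') = 1.
  have := congr1 (intr : int -> algC) abE; rewrite rmorphD !rmorphM /= ppE => E.
  by rewrite (_ : pi + pi' = 2 * e%:~R) // /pi /pi'; ring.
have E2 : al'%:~R * (pi * pi') + be'%:~R * r%:~R = 1.
  by have := congr1 (intr : int -> algC) abE'; rewrite rmorphD !rmorphM /= ppE.
have Oi : integers gauss_field 'i.
  split; first by apply: Qadjoin_mem; rewrite mem_head.
  by apply: Aint_sqrt; rewrite sqr_i Aint_int.
have OI (n : int) := integers_int fG n.
have OM := @integersM _ fG; have OD := @integersD _ fG; have OB := @integersB _ fG.
have O2 : integers gauss_field 2 := OI 2.
have Opi : integers gauss_field pi by apply: (OD) => //; apply: (OM) => //; exact: OM.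
have Opi' : integers gauss_field pi' by apply: (OB) => //; apply: (OM) => //; exact: OM.
pose X := al%:~R + be%:~R * pi'; pose Y := al'%:~R * pi'.
have OX : integers gauss_field X by apply: (OD) => //; exact: OM.
have OY : integers gauss_field Y by exact: OM.
exists (X + Y - pi * (X * Y)), (al%:~R * be'%:~R); split.
- by apply: (OB); [exact: OD | apply: (OM) => //; exact: OM].
- exact: OM.
have E1' : al%:~R * pi' = 1 - pi * X.
  transitivity (al%:~R * (pi + pi') + be%:~R * (pi * pi') - pi * X); first by rewrite /X; ring.
  by rewrite E1.
have E2' : be'%:~R * r%:~R = 1 - pi * Y.
  transitivity (al'%:~R * (pi * pi') + be'%:~R * r%:~R - pi * Y); first by rewrite /Y; ring.
  by rewrite E2.
transitivity ((X + Y - pi * (X * Y)) * pi + (al%:~R * pi') * (be'%:~R * r%:~R)); first by ring.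
by rewrite E1' E2'; ring.
Qed.

Lemma prime_above_gauss (p r : nat) (e f : int) H : prime p -> (p %% 4 = 1)%N ->
  p%:Z = e ^+ 2 + 4 * f ^+ 2 -> coprime p r -> ~ gauss_field (sqrtC (p * r)%:R) ->
  prime_ideal_above (biquadratic (p * r)) (e%:~R + 2 * 'i * f%:~R) H ->
  [/\ ideal_mul H H = principal_ideal (biquadratic (p * r)) (e%:~R + 2 * 'i * f%:~R),
      e%:~R + 2 * 'i * f%:~R != 0 :> algC & exists2 x, H x & x != 0].
Proof.
move=> p_pr p4 pE pr nGd HP.
have fG : is_subfield gauss_field := Qadjoin_subfield _.
have [//|u [v [Gu Gv uv1]]] := gauss_conjugates_coprime p_pr p4 pE (r := r%:Z).
set pi := e%:~R + _ in HP uv1 *; set pi' := e%:~R - _ in uv1.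
have i2 : 'i ^+ 2 + 1 = 0 :> algC by rewrite sqrCi addNr.
have ppE : pi * pi' = p%:R.
  rewrite -[p%:R]/((p%:Z)%:~R) pE !(rmorphD, rmorphM) /=.
  transitivity (e%:~R ^+ 2 + 4 * f%:~R ^+ 2 - 4 * f%:~R ^+ 2 * ('i ^+ 2 + 1) : algC).
    by rewrite /pi /pi'; ring.
  by rewrite i2 mulr0 subr0; ring.
have pi0 : pi != 0.
  apply/eqP => p0; move/eqP: ppE; rewrite p0 mul0r eq_sym pnatr_eq0.
  by have := prime_gt0 p_pr; case: (p).
have Oi : integers gauss_field 'i.
  split; first by apply: Qadjoin_mem; rewrite mem_head.
  by apply: Aint_sqrt; rewrite sqr_i Aint_int.
have OI (n : int) := integers_int fG n.
have OM := @integersM _ fG.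
have O2 : integers gauss_field 2 := OI 2.
have Opi : integers gauss_field pi.
  by apply: (integersD fG) => //; apply: (OM) => //; exact: OM.
have Opi' : integers gauss_field (pi' * r%:~R).
  by apply: (OM) => //; apply: (integersB fG) => //; apply: (OM) => //; exact: OM.
split=> //.
  apply: (prime_above_square _ nGd Opi Opi' Gu Gv pi0 uv1 HP).
  by rewrite sqrtCK mulrA ppE natrM.
exists pi => //; have [_ overH] := HP.
suff : (H `&` integers gauss_field) pi by case.
by rewrite overH; exists 1; [exact: integers1 | rewrite mulr1].
Qed.

(** * The fundamental unit and square roots in k *)

Lemma prime_dvd_square (q : nat) (n : int) : prime q -> (q%:Z %| n ^+ 2)%Z ->
  exists m, n = m * q%:Z.
Proof. by move=> q_pr; rewrite expr2 Euclid_dvdzM // orbb => /dvdzP. Qed.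

(** [s] is the sign in [square_pm]. The square is divisible by q, so its root is too; in the case
    with the factor 2, a further 2 comes out of the root because q is odd. *)
Lemma square_pm_prime_form (q : nat) (x : int) : prime q -> (- q%:Z = 1 %[mod 4])%Z ->
  square_pm q%:Z x \/ square_pm (2 * q%:Z) x ->
  exists s c m : int, [/\ s ^+ 2 = 1, c = 1 \/ c = 2 & x + s = c * q%:Z * m ^+ 2].
Proof.
move=> q_pr q4 sq.
have q0 : q%:Z != 0 by have := prime_gt0 q_pr; lia.
have [s [n [s1 nE]]] : exists s (n : nat), s ^+ 2 = 1 :> int /\
    (q%:Z * (x + s) = n%:Z ^+ 2 \/ 2 * q%:Z * (x + s) = n%:Z ^+ 2).
  by case: sq => -[n [nE|nE]]; [exists 1, n | exists (-1), n | exists 1, n | exists (-1), n];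
    (split; first by rewrite ?sqrrN expr1n); [left|left|right|right].
have [m mE] : exists m, n%:Z = m * q%:Z.
  apply: prime_dvd_square => //; apply/dvdzP.
  by case: nE => <-; [exists (x + s) | exists (2 * (x + s))]; ring.
case: nE => nE.
  exists s, 1, m; split; [by [] | by left |]; apply: (mulfI q0); rewrite nE mE; ring.
have mE2 : 2 * (x + s) = q%:Z * m ^+ 2.
  by apply: (mulfI q0); transitivity (2 * q%:Z * (x + s)); [ring | rewrite nE mE; ring].
have [m' m'E] : exists m', m = m' * 2%N%:Z.
  apply: prime_dvd_square => //.
  have : (2%N%:Z %| q%:Z * m ^+ 2)%Z by apply/dvdzP; exists (x + s); rewrite -mE2 mulrC.
  rewrite Euclid_dvdzM // => /orP[] // /dvdzP[a qE]; exfalso.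
  by have := divz_eq (- q%:Z) 4; rewrite q4 (_ : (1 %% 4)%Z = 1) // qE; lia.
exists s, 2, m'; split; [by [] | by right |].
by apply: (@mulfI _ 2) => //; rewrite mE2 m'E; ring.
Qed.

(** The norm of the inverse unit is rational, as inverse of an integer, and integral; hence the norm
    is an invertible integer. *)
Lemma fundamental_unit_norm (d : nat) (x y : int) (eps := x%:~R + y%:~R * sqrtC d%:R) :
  ~ gauss_field (sqrtC d%:R) -> integer_unit (Qadjoin [:: sqrtC d%:R]) eps ->
  x ^+ 2 - d%:Z * y ^+ 2 = 1 \/ x ^+ 2 - d%:Z * y ^+ 2 = -1.
Proof.
move=> nGd [Oe [v [Qv vA] ev]]; set w := sqrtC d%:R in nGd Qv eps Oe ev.
have fG : is_subfield gauss_field := Qadjoin_subfield _.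
have w2 : w ^+ 2 = (d%:Z)%:~R by exact: sqrtC_natK.
have Gw2 : gauss_field (w ^+ 2) by rewrite w2; exact: (subfield_int fG).
have [nu [nuF nuw]] := quadratic_conjugation Gw2 nGd.
have nuI (n : int) : nu n%:~R = n%:~R by rewrite rmorph_int.
pose N := x ^+ 2 - d%:Z * y ^+ 2.
have NE : eps * nu eps = N%:~R.
  rewrite /eps rmorphD rmorphM /= nuw !nuI /N !(rmorphB, rmorphM) /= -w2; ring.
have Nn : N%:~R * (v * nu v) = 1.
  by rewrite -NE mulrACA ev -rmorphM ev rmorph1 mulr1.
have N0 : N%:~R != 0 :> algC by apply: contra_eq_neq Nn => ->; rewrite mul0r eq_sym oner_eq0.
have : v * nu v \in Num.int.
  apply: Cint_rat_Aint; last by rewrite rpredM ?Aint_aut.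
  have -> : v * nu v = (N%:~R)^-1 by apply: (mulfI N0); rewrite Nn divff.
  by rewrite rpredV rpred_int.
case/intrP=> n nE; move: Nn; rewrite nE -intrM => /eqP; rewrite -[1]/(1%:~R) eqr_int => /eqP Nn.
have : (`|N| * `|n| = 1)%N by rewrite -abszM Nn.
move/eqP; rewrite muln_eq1 => /andP[/eqP N1 _]; rewrite -/N; clear -N1; lia.
Qed.

Lemma unit_square_multiple (p1 p2 q : nat) (x y : int) (d := (p1 * p2 * q)%N) :
  prime p1 -> prime p2 -> prime q -> (- q%:Z = 1 %[mod 4])%Z ->
  ~ gauss_field (sqrtC d%:R) ->
  fundamental_unit (Qadjoin [:: sqrtC d%:R]) (x%:~R + y%:~R * sqrtC d%:R) ->
  square_pm q%:Z x \/ square_pm (2 * q%:Z) x ->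
  exists gam eps : algC, [/\ biquadratic d gam, integers (biquadratic d) eps,
    integers (biquadratic d) eps^-1, eps != 0 & gam ^+ 2 = eps * (p1 * p2)%:R].
Proof.
move=> p1_pr p2_pr q_pr q4 nGd [unit_eps eps_gt1 _] /(square_pm_prime_form q_pr q4).
move=> [s [c [m [s1 c12 xsE]]]].
set k := biquadratic d; have fk : is_subfield k := Qadjoin_subfield _.
set w := sqrtC d%:R in nGd unit_eps eps_gt1.
have w2 : w ^+ 2 = (d%:Z)%:~R by exact: sqrtC_natK.
have q0 : q%:Z != 0 by have := prime_gt0 q_pr; lia.
pose P := (p1 * p2)%N%:Z; have dE : d%:Z = P * q%:Z by rewrite /P -PoszM.
(* Modulo q, x + s = 0 gives x^2 = 1, while norm -1 would give x^2 = -1; then q = 2, against the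
   congruence of q modulo 4. *)
have norm1 : x ^+ 2 - d%:Z * y ^+ 2 = 1.
  case: (fundamental_unit_norm nGd unit_eps) => // norm_1; exfalso.
  have : (q%:Z %| 2)%Z.
    apply/dvdzP; exists (P * y ^+ 2 - c * m ^+ 2 * (x - s)).
    have -> : (P * y ^+ 2 - c * m ^+ 2 * (x - s)) * q%:Z = P * q%:Z * y ^+ 2 - (c * q%:Z * m ^+ 2) * (x - s).
      by ring.
    rewrite -xsE -dE; have -> : d%:Z * y ^+ 2 = x ^+ 2 + 1 by rewrite -[1]opprK -norm_1; ring.
    have -> : x ^+ 2 + 1 - (x + s) * (x - s) = s ^+ 2 + 1 by ring.
    by rewrite s1.
  rewrite dvdzE => /dvdn_leq-/(_ isT) q_le; have q2 : q = 2%N.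
    by apply/eqP; rewrite eqn_leq q_le prime_gt1.
  by move: q4; rewrite q2.
(* m = 0 would give x = - s, then y = 0, and the unit would be 1 or -1 instead of exceeding 1. *)
have m0 : m != 0.
  apply/eqP => m0; move: xsE; rewrite m0 expr0n mulr0 => /eqP; rewrite addr_eq0 => /eqP xE.
  have y0 : y = 0.
    have : d%:Z * y ^+ 2 = 0.
      by move: norm1; rewrite xE sqrrN s1; move: (_ * _); lia.
    move/eqP; rewrite mulf_eq0 sqrf_eq0 => /orP[]/eqP // d0; case: nGd.
    rewrite /w -[d%:R]/((d%:Z)%:~R) d0 sqrtC0; exact: (subfield0 (Qadjoin_subfield _)).
  move: eps_gt1; rewrite y0 mul0r addr0 -[1]/(1%:~R) ltr_int xE.
  by move/eqP: s1; rewrite sqrf_eq1 => /orP[]/eqP->.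
have Py : c * m ^+ 2 * (x - s) = P * y ^+ 2.
  apply: (mulfI q0); transitivity (c * q%:Z * m ^+ 2 * (x - s)); first by ring.
  rewrite -xsE; transitivity (x ^+ 2 - s ^+ 2); first by ring.
  by rewrite s1 -{1}norm1 dE; ring.
pose M : algC := m%:~R; have M0 : M != 0 by rewrite intr_eq0.
pose eps : algC := x%:~R + y%:~R * w; rewrite -/eps in unit_eps eps_gt1.
have eps0 : eps != 0 by rewrite gt_eqF // (lt_trans ltr01).
have kw : k w by apply: Qadjoin_mem; rewrite mem_head.
have ki : k 'i by apply: Qadjoin_mem; rewrite !inE eqxx orbT.
have sub_wk : Qadjoin [:: w] `<=` k.
  by apply: Qadjoin_sub => // a; rewrite inE => /eqP->.
have [Oe [v Ov ev]] := unit_eps.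
have Oeps : integers k eps by exact: integers_subset Oe.
have OepsV : integers k eps^-1.
  by rewrite (_ : eps^-1 = v); [exact: integers_subset Ov | apply: (mulfI eps0); rewrite divff].
have KI (n : int) : k n%:~R := subfield_int fk n.
have KM := @subfieldM k fk; have KD := @subfieldD k fk.
have xsC : x%:~R + s%:~R = c%:~R * q%:~R * M ^+ 2 :> algC.
  by rewrite -intrD xsE !rmorphM /= -expr2.
have PyC : c%:~R * M ^+ 2 * (x%:~R - s%:~R) = P%:~R * y%:~R ^+ 2 :> algC.
  by rewrite -intrB /M -!rmorphXn -!rmorphM Py.
have w2C : w ^+ 2 = P%:~R * q%:~R by rewrite w2 dE rmorphM.
have PE : (p1 * p2)%:R = P%:~R :> algC by [].
have c0 : c%:~R != 0 :> algC by case: c12 => ->; rewrite intr_eq0.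
(* With suitable roots, 2 eps = (sqrt(x + s) + sqrt(x - s))^2, where x + s = c q m^2 and x - s = P
   y^2 / (c m^2). Multiplying the sum of roots by sqrt(P / c) leaves only the radical [w] and gives
   [g]. *)
pose g : algC := M * w + P%:~R * y%:~R / (c%:~R * M).
have gE : c%:~R * g ^+ 2 = 2 * eps * P%:~R.
  have -> : c%:~R * g ^+ 2 = P%:~R * (c%:~R * q%:~R * M ^+ 2)
      + 2 * P%:~R * y%:~R * w + P%:~R * (P%:~R * y%:~R ^+ 2) / (c%:~R * M ^+ 2).
    transitivity (c%:~R * M ^+ 2 * w ^+ 2 + 2 * P%:~R * y%:~R * w
      + P%:~R * (P%:~R * y%:~R ^+ 2) / (c%:~R * M ^+ 2)).
      by rewrite /g; field; rewrite M0 c0.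
    by rewrite w2C; ring.
  rewrite -xsC -PyC (_ : _ / _ = P%:~R * (x%:~R - s%:~R)); first by rewrite /eps; ring.
  by field; rewrite M0 c0.
have kg : k g.
  apply: (KD); first exact: (KM _ _ (KI m) kw).
  exact: (subfield_div fk (KM _ _ (KI P) (KI y)) (KM _ _ (KI c) (KI m))).
(* For c = 2 the factor 2 cancels; for c = 1 it is absorbed by (1 + i)^2 = 2 i, at the price of the
   unit i^-1. *)
case: c12 => cE; last first.
  exists g, eps; split=> //; rewrite PE; apply: (mulfI c0); rewrite gE cE; ring.
have i0 : 'i != 0 :> algC by rewrite neq0Ci.
have i2 : 'i ^+ 2 = -1 :> algC by rewrite sqrCi.
have t2 : (1 + 'i) ^+ 2 = 2 * 'i :> algC by rewrite sqrrD i2; ring.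
have t0 : 1 + 'i != 0 :> algC by rewrite -sqrf_eq0 t2 mulf_neq0 ?pnatr_eq0.
have Oi : integers k 'i by split=> //; apply: Aint_sqrt; rewrite sqr_i Aint_int.
have OiV : integers k 'i^-1 by rewrite invCi; exact: integersN.
exists (g / (1 + 'i)), ('i^-1 * eps); split.
- by apply: (subfield_div fk) => //; apply: (KD) => //; exact: subfield1.
- exact: integersM.
- by rewrite invfM invrK; exact: integersM.
- by rewrite mulf_neq0 ?invr_neq0.
rewrite expr_div_n PE; apply: (mulIf (expf_neq0 2 t0)); rewrite divfK ?expf_neq0 // t2.
transitivity (2 * eps * P%:~R); first by rewrite -gE cE mul1r.
by rewrite [RHS](_ : _ = 2 * eps * P%:~R * ('i^-1 * 'i)); [rewrite mulVf // mulr1 | ring].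
Qed.

(** * Capitulation in the genus field *)

Theorem theorem5p8 (p1 p2 q : nat)
  (p1_prime : prime p1) (p2_prime : prime p2) (q_prime : prime q)
  (p1_neq_p2 : p1 <> p2) (p1_neq_q : p1 <> q) (p2_neq_q : p2 <> q)
  (p1_mod4 : (p1%:Z = 1 %[mod 4])%Z) (p2_mod4 : (p2%:Z = 1 %[mod 4])%Z)
  (q_mod4 : (- q%:Z = 1 %[mod 4])%Z)
  (e f g h : nat)
  (p1E : p1 = (e ^ 2 + 4 * f ^ 2)%N) (p2E : p2 = (g ^ 2 + 4 * h ^ 2)%N)
  (k genus : set algC)
  (kE : k = biquadratic (p1 * p2 * q)%N)
  (genusP : absolute_genus_field k genus)
  (x y : int)
  (epsP : fundamental_unit (Qadjoin [:: sqrtC (p1 * p2 * q)%N%:R])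
            (x%:~R + y%:~R * sqrtC (p1 * p2 * q)%N%:R))
  (H1 H2 H3 H4 : set algC)
  (H1P : prime_ideal_above k (e%:R + 2 * 'i * f%:R) H1)
  (H2P : prime_ideal_above k (e%:R - 2 * 'i * f%:R) H2)
  (H3P : prime_ideal_above k (g%:R + 2 * 'i * h%:R) H3)
  (H4P : prime_ideal_above k (g%:R - 2 * 'i * h%:R) H4) :
  [/\ square_pm 1 x ->
        class_generated k [set ideal_class k H1; ideal_class k H2;
                               ideal_class k H3; ideal_class k H4]
          `<=` capitulation_kernel k genus,
      square_pm p1%:Z x \/ square_pm (2 * p1%:Z) x ->
        class_generated k [set ideal_class k H1; ideal_class k H3;
                               ideal_class k H4]
          `<=` capitulation_kernel k genus,
      square_pm p2%:Z x \/ square_pm (2 * p2%:Z) x ->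
        class_generated k [set ideal_class k H1; ideal_class k H2;
                               ideal_class k H3]
          `<=` capitulation_kernel k genus
    & square_pm q%:Z x \/ square_pm (2 * q%:Z) x ->
        class_generated k [set ideal_class k H1; ideal_class k H2;
                               ideal_class k H3]
        = class_generated k [set ideal_class k H1; ideal_class k H2;
                                 ideal_class k H4]
        /\ class_generated k [set ideal_class k H1; ideal_class k H2;
                                  ideal_class k H3]
             `<=` capitulation_kernel k genus].
Proof.
have [unr max_genus] := genusP; have [kgenus [L [phi [rphi _ _]]] _ _] := unr.
have fk : is_subfield k by rewrite kE; exact: Qadjoin_subfield.
have fg : is_subfield genus by rewrite -rphi; exact: number_field_subfield.
have K0 : Qadjoin [:: sqrtC p2%:R; sqrtC p1%:R; sqrtC (p1 * p2 * q)%:R; 'i] `<=` genus.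
  by apply: max_genus; rewrite kE; exact: multiquadratic_unramified.
have g1 : genus (sqrtC p1%:R) by apply: K0; apply: Qadjoin_mem; rewrite !inE eqxx orbT.
have g2 : genus (sqrtC p2%:R) by apply: K0; apply: Qadjoin_mem; rewrite !inE eqxx.
have gi : genus 'i by apply: K0; apply: Qadjoin_mem; rewrite !inE eqxx !orbT.
have nGd := sqrt_d_notin_gauss p1_prime p2_prime q_prime p1_neq_q p2_neq_q.
have mod4 (p : nat) : (p%:Z = 1 %[mod 4])%Z -> (p %% 4 = 1)%N by rewrite !modz_nat => -[].
(* One argument serves all four primes: [b] may have either sign, which covers both conjugates, and
   [r] is the cofactor of [p] in p1 p2 q. *)
have main (p r : nat) (a b : int) H : prime p -> (p %% 4 = 1)%N ->
    p%:Z = a ^+ 2 + 4 * b ^+ 2 -> coprime p r -> (p * r = p1 * p2 * q)%N ->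
    genus (sqrtC p%:R) -> prime_ideal_above k (a%:~R + 2 * 'i * b%:~R) H ->
    ideal_mul H H = principal_ideal k (a%:~R + 2 * 'i * b%:~R) /\
    capitulation_kernel k genus (ideal_class k H).
  move=> p_pr p4 pE copr dE gp HP; have [HH pi0 nzH] : [/\ ideal_mul H H
      = principal_ideal k (a%:~R + 2 * 'i * b%:~R), a%:~R + 2 * 'i * b%:~R != 0 :> algC
      & exists2 z, H z & z != 0].
    by rewrite kE -dE in HP *; apply: prime_above_gauss => //; rewrite dE.
  split=> //; have [be [ep [gb Oe Oe' e0 b2]]] := gauss_prime_unit_square fg gp gi p_pr p4 pE.
  by apply: (square_capitulates fk fg kgenus _ nzH HH pi0 gb Oe Oe' e0 b2); case: HP => -[].
have cop (a b c : nat) : prime a -> prime b -> prime c -> a <> b -> a <> c -> coprime a (b * c).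
  move=> a_pr b_pr c_pr ab ac; rewrite coprimeMr !prime_coprime // !dvdn_prime2 //.
  by apply/andP; split; apply/eqP.
have co1 := cop _ _ _ p1_prime p2_prime q_prime p1_neq_p2 p1_neq_q.
have co2 := cop _ _ _ p2_prime p1_prime q_prime (nesym p1_neq_p2) p2_neq_q.
have d1 : (p1 * (p2 * q) = p1 * p2 * q)%N by rewrite mulnA.
have d2 : (p2 * (p1 * q) = p1 * p2 * q)%N by rewrite mulnCA mulnA.
have form (p a b : nat) : p = (a ^ 2 + 4 * b ^ 2)%N -> p%:Z = a%:Z ^+ 2 + 4 * b%:Z ^+ 2.
  by move=> ->; rewrite PoszD PoszM !Posz_sqr.
have formN (p a b : nat) : p = (a ^ 2 + 4 * b ^ 2)%N -> p%:Z = a%:Z ^+ 2 + 4 * (- b%:Z) ^+ 2.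
  by move=> /form; rewrite sqrrN.
have negE (a b : nat) : a%:R - 2 * 'i * b%:R = (a%:Z)%:~R + 2 * 'i * (- b%:Z)%:~R :> algC.
  by rewrite rmorphN mulrN.
rewrite negE in H2P; rewrite negE in H4P.
have [HH1 C1] := main _ _ _ _ _ p1_prime (mod4 _ p1_mod4) (form _ _ _ p1E) co1 d1 g1 H1P.
have [HH2 C2] := main _ _ _ _ _ p1_prime (mod4 _ p1_mod4) (formN _ _ _ p1E) co1 d1 g1 H2P.
have [HH3 C3] := main _ _ _ _ _ p2_prime (mod4 _ p2_mod4) (form _ _ _ p2E) co2 d2 g2 H3P.
have [HH4 C4] := main _ _ _ _ _ p2_prime (mod4 _ p2_mod4) (formN _ _ _ p2E) co2 d2 g2 H4P.
split.
- by move=> _; apply: class_generated_capitulates => // c [[[->|->]|->]|->].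
- by move=> _; apply: class_generated_capitulates => // c [[->|->]|->].
- by move=> _; apply: class_generated_capitulates => // c [[->|->]|->].
move=> sq; split; last by apply: class_generated_capitulates => // c [[->|->]|->].
have [gam [ep [kgam Oe Oe' e0 gam2]]] :=
  unit_square_multiple p1_prime p2_prime q_prime q_mod4 nGd epsP sq.
rewrite -kE in kgam Oe Oe'.
have gam0 : gam != 0.
  by rewrite -sqrf_eq0 gam2 mulf_neq0 // pnatr_eq0 -lt0n muln_gt0 !prime_gt0.
have subH H pi : prime_ideal_above k pi H -> submodule k H by case=> -[[]].
have subM I J : submodule k I -> submodule k J -> submodule k (ideal_mul I J).
  by move=> sI sJ; apply: submodule_mul => //; case: sI.
(* The square of this product is generated by the product of the four Gaussian primes, which is p1
   p2, and so by gam^2; [square_principal] applies within k itself. *)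
have prodE : ideal_mul (ideal_mul (ideal_mul H1 H2) H3) H4 = principal_ideal k gam.
  apply: square_principal => //.
    by do !apply: (subM); [exact: (subH _ _ H1P) | exact: (subH _ _ H2P)
      | exact: (subH _ _ H3P) | exact: (subH _ _ H4P)].
  rewrite ideal_mulACA HH4 ideal_mulACA HH3 ideal_mulACA HH1 HH2 !principal_mul //.
  rewrite gam2 (principal_unit _ fk Oe Oe' e0); congr (principal_ideal k _).
  have i2 : 'i ^+ 2 + 1 = 0 :> algC by rewrite sqrCi addNr.
  have normE (a b : nat) : (a%:R + 2 * 'i * b%:R) * (a%:R + 2 * 'i * - b%:R)
      = (a ^ 2 + 4 * b ^ 2)%:R :> algC.
    rewrite natrD natrM !natrX.
    transitivity (a%:R ^+ 2 + 4 * b%:R ^+ 2 - 4 * b%:R ^+ 2 * ('i ^+ 2 + 1) : algC); first by ring.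
    by rewrite i2 mulr0 subr0.
  by rewrite !rmorphN /= normE -p1E -mulrA normE -p2E natrM.
have prod1 : class_mul (class_mul (class_mul (ideal_class k H1) (ideal_class k H2))
    (ideal_class k H3)) (ideal_class k H4) = class_one k.
  by rewrite !class_mulE // prodE class_principal.
have [cg3 _] := C3; have [cg4 _] := C4.
apply: class_generated_eq => S sS; have [_ _ SM Sinv] := sS.
split=> XS.
  have S1 : S (ideal_class k H1) by apply: XS; left; left.
  have S2 : S (ideal_class k H2) by apply: XS; left; right.
  have S3 : S (ideal_class k H3) by apply: XS; right.
  move=> c [[->|->]|->] //; apply: (Sinv _ _ _ cg4 prod1).
  by apply: (SM) => //; exact: SM.
have S1 : S (ideal_class k H1) by apply: XS; left; left.
have S2 : S (ideal_class k H2) by apply: XS; left; right.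
have S4 : S (ideal_class k H4) by apply: XS; right.
move=> c [[->|->]|->] //.
apply: (Sinv (class_mul (class_mul (ideal_class k H1) (ideal_class k H2)) (ideal_class k H4)) _ _ cg3).
  by apply: (SM) => //; exact: SM.
by rewrite -class_mulA (class_mulC (ideal_class k H4)) class_mulA.
Qed.
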